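(* Let $\mu$ be an atom-free, zero-mean probability measure on $(\mathbb{R},\mathcal{B}(\mathbb{R}))$. Then the regular barrier function $r$ of the Root solution of the Skorokhod embedding problem for $\mu$ solves the nonlinear Volterra integral equation $$u_{\delta_0}(x)-u_\mu(x)=g\bigl(r(x),x\bigr)-\int_{\{y:\,r(y)<r(x)\}}g\bigl(r(x)-r(y),x-y\bigr)\,\mu(\mathrm{d}y)\qquad\text{for all }x\in(-\infty,\infty).$$
   Context: $B=(B_t)_{t\ge 0}$ is a standard one-dimensional Brownian motion started at $0$. A stopping time $\tau$ solves the Skorokhod embedding problem for $\mu$ if $B_\tau\sim\mu$ and $B^\tau=(B_{t\wedge\tau})_{t\ge0}$ is uniformly integrable. A Root barrier is a closed set $R\subset[0,\infty]\times[-\infty,\infty]$ such that (1) $(t,x)\in R$ implies $(t+h,x)\in R$ for all $h\ge0$; (2) $(+\infty,x)\in R$ for all $x\in[-\infty,\infty]$; (3) $(t,\pm\infty)\in R$ for all $t\in[0,+\infty]$. Its barrier function is $r:[-\infty,\infty]\to[0,\infty]$, $r(x)=\inf\{t\ge0:(t,x)\in R\}$; one has $R=\{(t,x):t\ge r(x)\}$. The first positive zero of $r$ is the point $x_+\in[0,\infty]$ with $r(x_+)=0$ and $r(x)>0$ for $x\in[0,x_+)$; the first negative zero $x_-\in[-\infty,0]$ is defined analogously. $R$ (or $r$) is called regular if $r$ vanishes outside $[x_-,x_+]$. For every zero-mean probability measure $\mu$ on $\mathbb{R}$ there is exactly one regular Root barrier $R$ such that $\tau=\inf\{t>0:(t,B_t)\in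 R\}$ solves the Skorokhod embedding problem for $\mu$ (Root, Loynes, Rost); this $\tau$ is the Root solution, and the barrier function of $R$ is its regular barrier function. For a probability measure $\nu$ with finite first moment, $u_\nu(x)=-\int_{\mathbb{R}}|x-y|\,\nu(\mathrm{d}y)$ is its potential function; $\delta_0$ is the Dirac measure at $0$, so $u_{\delta_0}(x)=-|x|$. Further $$g(t,x)=\sqrt{\tfrac{2t}{\pi}}\,e^{-x^2/(2t)}-|x|\operatorname{Erfc}\Bigl(\tfrac{|x|}{\sqrt{2t}}\Bigr)=\mathbb{E}[L_t^x]$$ (so $g(0,x)=0$), where $(L_t^x)_{t,x}$ is the local time of $B$ and $\operatorname{Erfc}(z)=\frac{2}{\sqrt\pi}\int_z^\infty e^{-v^2}\mathrm{d}v$.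
   Formalization: At points x with r(x)=+∞ (e.g. in a gap of the support of μ) the right-hand side is ∞−∞; there the equation is read as: the right-hand side with r(x) replaced by finite s tends to u_{δ_0}(x)−u_μ(x) as s→+∞. *)

(* Defs.v *)
From HB Require Import structures.
From mathcomp Require Import all_boot all_order all_algebra.
From mathcomp Require Import all_classical all_reals all_analysis.

Set Implicit Arguments.
Unset Strict Implicit.
Unset Printing Implicit Defensive.

Import Order.TTheory GRing.Theory Num.Theory.
Import numFieldNormedType.Exports.

Local Open Scope classical_set_scope.
Local Open Scope ring_scope.

(** A process is a family [B : R -> {RV P >-> R}]; only the times [0 <= t] are
    ever used. *)
Section Process.
Context (R : realType) (d : measure_display) (Omega : measurableType d).
Context (P : probability Omega R) (B : R -> {RV P >-> R}).

(** sigma(B_u ; 0 <= u <= t) *)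
Definition natural_filtration (t : R) : set (set Omega) :=
  <<s \bigcup_(u in `[0, t]) preimage_set_system setT (B u) measurable >>.

(** F_{t+}, the intersection of the F_s over s > t *)
Definition right_filtration (t : R) : set (set Omega) :=
  \bigcap_(s in `]t, +oo[) natural_filtration s.

Record brownian_motion : Prop := BrownianMotion {
  bm_start : forall w, B 0 w = 0;
  bm_continuous : forall w, {within `[0, +oo[, continuous (fun t : R => B t w)};
  (* the second parameter of [normal_prob] is the standard deviation *)
  bm_gaussian : forall s t : R, 0 <= s -> s < t ->
    forall A : set R, measurable A ->
      P [set w | A (B t w - B s w)] = normal_prob 0 (Num.sqrt (t - s)) A;
  bm_independent : forall s t : R, 0 <= s -> s < t ->
    forall (E : set Omega) (A : set R),
      natural_filtration s E -> measurable A ->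
      P (E `&` [set w | A (B t w - B s w)]) =
        (P E * P [set w | A (B t w - B s w)%R])%E }.

(** The right-continuous filtration is used because a first hitting time over
    [t > 0] need not be a stopping time of the raw natural filtration. *)
Definition stopping_time (tau : Omega -> \bar R) : Prop :=
  (forall w, 0 <= tau w)%E /\
  forall t : R, 0 <= t -> right_filtration t [set w | (tau w <= t%:E)%E].

Definition uniformly_integrable (X : R -> Omega -> R) : Prop :=
  forall e : R, 0 < e -> exists K : R, forall t : R, 0 <= t ->
    (\int[P]_(w in [set w | (K <= `|X t w|)%R]) (`|X t w|)%:E <= e%:E)%E.

Definition stopped_value (tau : Omega -> \bar R) (w : Omega) : R :=
  B (fine (tau w)) w.

Definition stopped_process (tau : Omega -> \bar R) (t : R) : Omega -> R :=
  stopped_value (fun w => mine t%:E (tau w)).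

(** [fine +oo = 0], so finiteness of [tau], implicit in B_tau ~ mu, is made
    explicit. *)
Record solves_skorokhod (mu : probability (measurableTypeR R) R)
    (tau : Omega -> \bar R) : Prop := SolvesSkorokhod {
  sk_stopping : stopping_time tau;
  sk_finite : P [set w | tau w = +oo%E] = 0%E;
  sk_law : forall A : set (measurableTypeR R), measurable A ->
    P (stopped_value tau @^-1` A) = mu A;
  sk_ui : uniformly_integrable (stopped_process tau) }.

(** inf {t > 0 : (t, B_t) in Rb}, with value [+oo] if the set is empty *)
Definition root_time (Rb : set (\bar R * \bar R)) (w : Omega) : \bar R :=
  ereal_inf [set t%:E | t in [set t : R | 0 < t /\ Rb (t%:E, (B t w)%:E)]].

End Process.

Section Barrier.
Context (R : realType).
Local Open Scope ereal_scope.

(** Since [0, +oo] x [-oo, +oo] is closed in the square of the extended reals,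
    closedness in the former and in the latter agree. *)
Record root_barrier (Rb : set (\bar R * \bar R)) : Prop := RootBarrier {
  rb_time_ge0 : forall t x, Rb (t, x) -> 0 <= t;
  rb_closed : closed Rb;
  rb_shift : forall t x h, Rb (t, x) -> 0 <= h -> Rb (t + h, x);
  rb_infty_time : forall x, Rb (+oo, x);
  rb_infty_space : forall t, 0 <= t -> Rb (t, +oo) /\ Rb (t, -oo) }.

Definition barrier_function (Rb : set (\bar R * \bar R)) (x : \bar R) : \bar R :=
  ereal_inf [set t | 0 <= t /\ Rb (t, x)].

Definition first_positive_zero (r : \bar R -> \bar R) (xp : \bar R) : Prop :=
  [/\ 0 <= xp, r xp = 0 & forall x, 0 <= x -> x < xp -> 0 < r x].

Definition first_negative_zero (r : \bar R -> \bar R) (xn : \bar R) : Prop :=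
  [/\ xn <= 0, r xn = 0 & forall x, xn < x -> x <= 0 -> 0 < r x].

Definition regular_barrier (r : \bar R -> \bar R) : Prop :=
  exists xn xp, [/\ first_negative_zero r xn, first_positive_zero r xp &
    forall x, x < xn \/ xp < x -> r x = 0].

End Barrier.

Section Volterra.
Context (R : realType).

Definition atom_free (mu : probability (measurableTypeR R) R) : Prop :=
  forall x : R, mu [set x] = 0%E.

Definition zero_mean (mu : probability (measurableTypeR R) R) : Prop :=
  mu.-integrable setT (fun x => x%:E) /\ (\int[mu]_x x%:E = 0)%E.

Definition potential (nu : probability (measurableTypeR R) R) (x : R) : R :=
  - \int[nu]_(y in setT) `|x - y|.

Definition Erfc (z : R) : R :=
  2 / Num.sqrt pi * \int[lebesgue_measure]_(v in `[z, +oo[) expR (- v ^+ 2).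

(** E[L_t^x].  The case [t = 0] is separate: there the formula divides by 0,
    which with the convention [0^-1 = 0] would give [- `|x|] instead of 0. *)
Definition g (t x : R) : R :=
  if t <= 0 then 0 else
  Num.sqrt (2 * t / pi) * expR (- x ^+ 2 / (2 * t))
  - `|x| * Erfc (`|x| / Num.sqrt (2 * t)).

(** Right-hand side of the Volterra equation with [r x] replaced by the real
    number [s]; [r y] is finite on the domain of integration. *)
Definition volterra_rhs (mu : probability (measurableTypeR R) R)
    (r : \bar R -> \bar R) (s x : R) : R :=
  g s x - \int[mu]_(y in [set y : R | (r y%:E < s%:E)%E])
            g (s - fine (r y%:E)) (x - y).

(** The equation at [x]: if [r x = +oo] the two terms on the right are both
    infinite, and their difference is the limit of the right-hand side as the
    finite time [s] replacing [r x] tends to [+oo]. *)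
Definition volterra_equation_at (mu : probability (measurableTypeR R) R)
    (r : \bar R -> \bar R) (x : R) : Prop :=
  let lhs := potential \d_(0 : measurableTypeR R) x - potential mu x in
  (forall s : R, r x%:E = s%:E -> lhs = volterra_rhs mu r s x) /\
  (r x%:E = +oo%E -> volterra_rhs mu r s x @[s --> +oo] --> lhs).

End Volterra.

(* Main.v *)
(** Write [tau] for the Root time, [T] for the value of [B] at [tau], and recall
    that [g(t, x) = E|B_t - x| - |x|].  Stopping the martingale
    [|B_v - x| + g(s - v, x - B_v)] at [tau /\ s] gives, for every [s > 0],
      [g(s, x) = E|B_(tau /\ s) - x| - |x| + E[g(s - tau, x - T); tau < s]].
    Since [mu] has no atoms, [tau = r(T)] almost surely: by continuity of the path,
    [r(T) < tau] puts [T] in the countable set of points at which [r] jumps up on one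
    side.  So the last expectation is the integral against [mu] in the Volterra
    equation.  If [s >= r(x)], the path cannot cross [x] between [s] and [tau], hence
    [E|B_(tau /\ s) - x| = E|T - x|] by uniform integrability, which is the equation at
    [s = r(x) > 0].  If [r(x) = 0], let [s] tend to 0; if [r(x) = +oo], let [s] tend to
    [+oo], using uniform integrability again. *)
Require Import Defs.
From HB Require Import structures.
From mathcomp Require Import all_boot all_order all_algebra.
From mathcomp Require Import all_classical all_reals all_analysis.
From mathcomp Require Import measurable_realfun ring lra.

Set Implicit Arguments.
Unset Strict Implicit.
Unset Printing Implicit Defensive.

Import Order.TTheory GRing.Theory Num.Theory.
Import numFieldNormedType.Exports.

Local Open Scope classical_set_scope.
Local Open Scope ring_scope.

(** * Gaussian integrals *)

(** The closed formula of [g] acts mostly through [g t x = E|B_t - x| - |x|]: the Gaussian integrals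
    establish this identity, and the sign and the modulus of continuity of [g] are then read off
    from a Brownian path.

    Optional stopping is delicate because [tau] is a stopping time of the right-continuous
    filtration only, while increments are independent of the raw one. A grid time strictly after
    [tau] restores the raw filtration, and the limit along finer grids needs uniform integrability,
    which an L2 bound supplies. Such a bound is at hand on bounded time intervals, so this argument
    is confined to the event [tau < t]; the passage to [tau] itself rests on the uniform
    integrability contained in the notion of solution.

    That the path does not cross [x] between [s] and [tau] makes the absolute value linear: [T - x]
    and [B_s - x] have the same weak sign, so the comparison of the two distances reduces to a
    martingale identity on each of the events [B_s > x] and [B_s <= x] within [tau >= s]. *)

Section Gaussian.
Context {R : realType}.
Local Notation leb := (@lebesgue_measure R).
Local Notation N t := (normal_prob 0 (Num.sqrt t)).

Lemma ge0_integral_normal_prob (m s : R) (f : R -> \bar R) :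
  measurable_fun [set: R] f -> (forall x, (0 <= f x)%E) ->
  (\int[normal_prob m s]_x f x = \int[leb]_x (f x * (normal_pdf m s x)%:E))%E.
Proof.
move=> mf f0.
have dom := @normal_prob_dominates R m s.
rewrite -(Radon_Nikodym_SigmaFinite.change_of_variables dom f0)//.
apply: ae_eq_integral => //.
- apply: emeasurable_funM => //.
  exact: (measurable_int _ (Radon_Nikodym_SigmaFinite.f_integrable dom)).
- apply: emeasurable_funM => //; apply/measurable_EFinP.
  exact: measurable_normal_pdf.
(* The abstract Radon-Nikodym derivative and the explicit density agree almost everywhere, because
   they have equal integrals over every measurable set. *)
have : ae_eq leb setT (Radon_Nikodym_SigmaFinite.f (normal_prob m s) leb)
    (fun x => (normal_pdf m s x)%:E).
  apply: (integral_ae_eq measurableT).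
  - exact: Radon_Nikodym_SigmaFinite.f_integrable.
  - by apply/measurable_EFinP; exact: measurable_normal_pdf.
  - by move=> A _ mA; rewrite -Radon_Nikodym_SigmaFinite.f_integral.
by apply: filterS => x /= + _ => /(_ I) ->.
Qed.

Lemma normal_pdfN (s z : R) : s != 0 -> normal_pdf 0 s (- z) = normal_pdf 0 s z.
Proof. by move=> s0; rewrite !normal_pdfE// /normal_fun !subr0 sqrrN. Qed.

Lemma ge0_integral_normal_probN (s : R) (f : R -> \bar R) : s != 0 ->
  measurable_fun [set: R] f -> (forall x, (0 <= f x)%E) ->
  (\int[normal_prob 0 s]_x f (- x)%R = \int[normal_prob 0 s]_x f x)%E.
Proof.
move=> s0 mf f0.
have mN : measurable_fun [set: R] (fun x : R => - x).
  exact: oppr_measurable.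
rewrite !ge0_integral_normal_prob//; last exact: measurableT_comp.
under eq_integral do rewrite -normal_pdfN//.
have mh : measurable_fun [set: R] (fun x => (f x * (normal_pdf 0 s x)%:E)%E).
  apply: emeasurable_funM => //; apply/measurable_EFinP.
  exact: measurable_normal_pdf.
transitivity (\int[pushforward leb (-%R : _ -> measurableTypeR R)]_x
    (f x * (normal_pdf 0 s x)%:E))%E.
  rewrite ge0_integral_pushforward//= => y _.
  by rewrite mule_ge0// lee_fin normal_pdf_ge0.
by apply: eq_measure_integral => A mA _; exact: lebesgue_measureN.
Qed.

(** An antiderivative for the first moment; the factor [s ^+ 2] cancels the variance produced by
    differentiating the exponent. *)
Lemma derive_normal_pdf (s z : R) : s != 0 ->
  is_derive z 1 (fun y : R => - (s ^+ 2 * normal_pdf 0 s y)) (z * normal_pdf 0 s z).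
Proof.
move=> s0; rewrite normal_pdfE// /normal_fun.
have -> : (fun y : R => - (s ^+ 2 * (normal_peak s * expR (- (y - 0) ^+ 2 / (s ^+ 2 *+ 2)))))
  = (fun y : R => (- s ^+ 2 * normal_peak s) * expR (- (s ^+ 2 *+ 2)^-1 * y ^+ 2)).
  apply/funext => y; rewrite subr0 -mulNr mulrA; congr (_ * expR _).
  by rewrite mulNr mulrC mulNr.
apply: is_derive_eq.
have -> : - (z - 0) ^+ 2 / (s ^+ 2 *+ 2) = - (s ^+ 2 *+ 2)^-1 * z ^+ 2.
  by rewrite subr0 mulNr mulrC mulNr.
rewrite /GRing.scale/=; set e := expR _.
by field.
Qed.

Lemma integral_id_normal_pdf (s a : R) : s != 0 -> 0 <= a ->
  (\int[leb]_(z in `[a, +oo[) (z * normal_pdf 0 s z)%:E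
    = (s ^+ 2 * normal_pdf 0 s a)%:E)%E.
Proof.
move=> s0 a0.
have cp := @continuous_normal_pdf R 0 s s0.
have dF z := derive_normal_pdf z s0.
have cF : continuous (fun y : R => - (s ^+ 2 * normal_pdf 0 s y)).
  by move=> z; apply/differentiable_continuous/derivable1_diffP; case: (dF z).
rewrite (@ge0_continuous_FTC2y R _ (fun y => - (s ^+ 2 * normal_pdf 0 s y)) a 0).
- by rewrite sub0e -EFinN opprK.
- by move=> x ax; rewrite mulr_ge0 ?normal_pdf_ge0// (le_trans a0).
- by apply: continuous_subspaceT => z; apply: cvgM; [exact: cvg_id|exact: cp].
- have -> : (fun y => - (s ^+ 2 * normal_pdf 0 s y)) =
      (fun y : R => (- s ^+ 2 * normal_peak s) * expR (- ((s ^+ 2 *+ 2)^-1 * y ^+ 2))).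
    apply/funext => y; rewrite normal_pdfE// /normal_fun subr0 -mulNr mulrA.
    by congr (_ * expR _); rewrite mulNr mulrC.
  rewrite -(mulr0 (- s ^+ 2 * normal_peak s)); apply: cvgM; first exact: cvg_cst.
  apply: (cvg_comp (fun y : R => (s ^+ 2 *+ 2)^-1 * y ^+ 2) (fun y => expR (- y)));
    last exact: cvgr_expR.
  apply: gt0_cvgMry; last exact: cvgr_expr2.
  by rewrite invr_gt0 pmulrn_lgt0// exprn_even_gt0.
- by move=> x _; case: (dF x).
- by apply: cvg_at_right_filter; exact: cF.
- by move=> z _; rewrite derive1E; apply: derive_val.
Qed.

(** Substituting [v = z / sqrt (2 t)] turns the normal exponent into [- v ^ 2]; the peak
    [1 / sqrt (2 pi t)] then leaves one half of the normalisation of [Erfc]. *)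
Lemma normal_tail_Erfc (t a : R) : 0 < t ->
  (\int[leb]_(z in `[a, +oo[) (normal_pdf 0 (Num.sqrt t) z)%:E
    = (Erfc (a / Num.sqrt (2 * t)) / 2)%:E)%E.
Proof.
move=> t0; have st0 : Num.sqrt t != 0 by rewrite gt_eqF// sqrtr_gt0.
set c := (Num.sqrt (2 * t))^-1.
have c0 : 0 < c by rewrite invr_gt0 sqrtr_gt0 mulr_gt0.
have dF : derive1 (fun u : R => u * c) = cst c.
  apply/funext => u; rewrite derive1E.
  have D : is_derive u 1 (fun u : R => u * c) c.
    by apply: is_derive_eq; rewrite /GRing.scale/= mulr0 add0r mulr1.
  exact: derive_val.
have H := @increasing_ge0_integration_by_substitutiony R (fun u => u * c) (@gauss_fun R) a.
have {H} HI : (\int[leb]_(v in `[(a * c)%R, +oo[) (expR (- v ^+ 2))%:E =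
    c%:E * \int[leb]_(z in `[a, +oo[) (normal_fun 0 (Num.sqrt t) z)%:E)%E.
  rewrite H.
  - rewrite dF -ge0_integralZl//=; last 3 first.
    + by apply/measurable_EFinP/measurable_funTS; exact: measurable_normal_fun.
    + by move=> z _; rewrite lee_fin normal_fun_ge0.
    + by rewrite lee_fin ltW.
    apply: eq_integral => z _; rewrite -EFinM; congr EFin.
    rewrite /= mulrC; congr (_ * expR _).
    rewrite /c subr0 sqr_sqrtr ?(ltW t0)// exprMn exprVn sqr_sqrtr ?mulr_ge0 ?(ltW t0)//.
    by rewrite mulNr mulr_natl.
  - by move=> x y _ _ xy; rewrite ltr_pM2r.
  - by rewrite dF => x _; exact: cvg_cst.
  - by rewrite dF; exact: is_cvg_cst.
  - by rewrite dF; exact: is_cvg_cst.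
  - split; first by move=> x _; exact: derivableM.
    by apply: cvg_at_right_filter; apply: cvgM; [exact: cvg_id|exact: cvg_cst].
  - by apply: gt0_cvgMly => //; exact: cvg_id.
  - by apply: continuous_subspaceT; exact: continuous_gauss_fun.
  - by move=> x _; exact: gauss_fun_ge0.
rewrite /Erfc /Rintegral HI.
have pk0 : 0 < normal_peak (Num.sqrt t) by rewrite normal_peak_gt0.
have Ip : (\int[leb]_(z in `[a, +oo[) (normal_pdf 0 (Num.sqrt t) z)%:E =
  (normal_peak (Num.sqrt t))%:E * \int[leb]_(z in `[a, +oo[) (normal_fun 0 (Num.sqrt t) z)%:E)%E.
  rewrite -ge0_integralZl//=; last 3 first.
  + by apply/measurable_EFinP/measurable_funTS; exact: measurable_normal_fun.
  + by move=> z _; rewrite lee_fin normal_fun_ge0.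
  + by rewrite lee_fin ltW.
  by apply: eq_integral => z _; rewrite normal_pdfE// EFinM.
(* [Erfc] is a real integral, so finiteness is needed before passing to [fine]. It is inherited from
   the normalised density, whose total mass is 1. *)
have If : (\int[leb]_(z in `[a, +oo[) (normal_fun 0 (Num.sqrt t) z)%:E \is a fin_num)%E.
  rewrite ge0_fin_numE; last by apply: integral_ge0 => z _; rewrite lee_fin normal_fun_ge0.
  have : (\int[leb]_(z in `[a, +oo[) (normal_pdf 0 (Num.sqrt t) z)%:E < +oo)%E.
    apply: (@le_lt_trans _ _ (\int[leb]_z (normal_pdf 0 (Num.sqrt t) z)%:E)%E).
      apply: ge0_subset_integral => //.
      - by apply/measurable_EFinP; exact: measurable_normal_pdf.
      - by move=> z _; rewrite lee_fin normal_pdf_ge0.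
    by rewrite integral_normal_pdf ltry.
  rewrite Ip; case: (integral _ _ _) => [r _| |_].
  - exact: ltry.
  - by rewrite gt0_muley ?lte_fin.
  - by [].
rewrite Ip -(fineK If) -!EFinM; congr EFin => /=.
set I := fine _.
rewrite mulrA mulrAC; congr (_ * _).
rewrite /normal_peak sqr_sqrtr ?(ltW t0)// /c.
have -> : t * pi *+ 2 = pi * (2 * t) :> R by rewrite -mulr_natl; ring.
rewrite sqrtrM ?pi_ge0// invfM.
by field; rewrite !gt_eqF ?sqrtr_gt0 ?pi_gt0 ?mulr_gt0.
Qed.

(** This is [E[max (Z - a, 0)]] for a centred normal [Z] of variance [t], split into a first moment
    and a tail mass; [0 <= a] keeps the integrand of the first moment nonnegative. *)
Lemma integral_normal_tail (t a : R) : 0 < t -> 0 <= a ->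
  (\int[normal_prob 0 (Num.sqrt t)]_(z in `[a, +oo[) (z - a)%:E
   = (t * normal_pdf 0 (Num.sqrt t) a - a * (Erfc (a / Num.sqrt (2 * t)) / 2))%:E)%E.
Proof.
move=> t0 a0; have st0 : Num.sqrt t != 0 by rewrite gt_eqF// sqrtr_gt0.
have mitv : measurable `[a, +oo[%classic by exact: measurable_itv.
have I1 := integral_id_normal_pdf st0 a0.
have I2 := normal_tail_Erfc a t0.
have mp : measurable_fun `[a, +oo[%classic (fun z => normal_pdf 0 (Num.sqrt t) z).
  by apply: measurable_funTS; exact: measurable_normal_pdf.
rewrite integral_mkcond ge0_integral_normal_prob//; last 2 first.
- apply/(measurable_restrictT _ mitv); apply/measurable_EFinP/measurable_funB => //.
- move=> z; rewrite /patch; case: ifPn => //; rewrite inE/= in_itv/= andbT => az.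
  by rewrite lee_fin subr_ge0.
transitivity (\int[leb]_(z in `[a, +oo[)
    ((z * normal_pdf 0 (Num.sqrt t) z)%:E -
     (a * normal_pdf 0 (Num.sqrt t) z)%:E))%E.
  rewrite [RHS]integral_mkcond; apply: eq_integral => z _.
  rewrite /patch; case: ifPn => _; last by rewrite mul0e.
  by rewrite -EFinM -EFinB mulrBl.
have int2 : leb.-integrable `[a, +oo[ (fun z => (normal_pdf 0 (Num.sqrt t) z)%:E).
  by apply: (integrableS measurableT) => //; exact: integrable_normal_pdf.
rewrite integralB//; last 2 first.
- apply/integrableP; split; first by apply/measurable_EFinP/measurable_funM.
  under eq_integral => z.
    rewrite inE/= in_itv/= andbT => az.
    rewrite ger0_norm; last by rewrite mulr_ge0 ?normal_pdf_ge0// (le_trans a0).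
    over.
  by rewrite I1 ltry.
- rewrite (_ : (fun z => _) = (fun z => a%:E * (normal_pdf 0 (Num.sqrt t) z)%:E)%E).
    exact: integrableZl.
  by apply/funext => z; rewrite EFinM.
rewrite I1; under eq_integral do rewrite EFinM.
by rewrite integralZl// I2 -EFinM -EFinB sqr_sqrtr// ltW.
Qed.

(** The positive and the negative part of [z] have equal integrals by symmetry, and the tail
    integral at [a = 0] shows that the common value is finite. *)
Lemma integrable_normal_id (t : R) : 0 < t ->
  (normal_prob 0 (Num.sqrt t)).-integrable [set: R] (fun z => z%:E).
Proof.
move=> t0; have st0 : Num.sqrt t != 0 by rewrite gt_eqF// sqrtr_gt0.
have I := integral_normal_tail t0 (lexx 0).
apply/integrableP; split; first exact/measurable_EFinP.
have mm : measurable (`[0%R, +oo[%classic : set (measurableTypeR R)) by exact: measurable_itv.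
have E0 : (\int[N t]_z (Num.max z 0)%:E = \int[N t]_(z in `[0%R, +oo[) (z - 0)%:E)%E.
  rewrite [RHS]integral_mkcond; apply: eq_integral => z _.
  rewrite /patch mem_setE in_itv/= andbT subr0; case: leP => //.
have E1 : (\int[N t]_z (Num.max (- z) 0)%:E = \int[N t]_z (Num.max z 0)%:E)%E.
  rewrite (@ge0_integral_normal_probN _ (fun z => (Num.max z 0)%:E))//.
  - exact/measurable_EFinP/measurable_maxr.
  - by move=> z; rewrite lee_fin le_max lexx orbT.
have -> : (\int[N t]_z `|z%:E| = \int[N t]_z ((Num.max z 0)%:E + (Num.max (- z) 0)%:E))%E.
  apply: eq_integral => z _; rewrite /= -EFinD; congr EFin.
  by case: (leP 0 z) => z0; [rewrite ger0_norm// max_r ?addr0// oppr_le0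
                            |rewrite ltr0_norm// max_l ?add0r// oppr_ge0 ltW].
rewrite ge0_integralD//.
- by rewrite E1 E0 I -EFinD ltry.
- by move=> z _; rewrite lee_fin le_max lexx orbT.
- exact/measurable_EFinP/measurable_maxr.
- by move=> z _; rewrite lee_fin le_max lexx orbT.
- by apply/measurable_EFinP/measurable_maxr => //; exact: oppr_measurable.
Qed.

Lemma integral_normal_id (t : R) : 0 < t ->
  (\int[normal_prob 0 (Num.sqrt t)]_z z%:E = 0)%E.
Proof.
move=> t0; have st0 : Num.sqrt t != 0 by rewrite gt_eqF// sqrtr_gt0.
have I := integrable_normal_id t0.
have fI := integrable_fin_num measurableT I.
rewrite integralE.
have -> : (\int[N t]_z ((fun z => z%:E)^\- z) = \int[N t]_z ((fun z => z%:E)^\+ z))%E.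
  rewrite -(@ge0_integral_normal_probN _ (fun z => (fun z => z%:E)^\+ z)%E)//.
  - by apply: eq_integral => z _; rewrite funenegE funeposE EFinN.
  - exact/measurable_funepos/measurable_EFinP.
by rewrite subee//; apply: integrable_pos_fin_num.
Qed.

(** Domination by a multiple of the normal density of variance [2 t]: half of the exponent absorbs
    the square at the price of a factor [4 t], and [c] combines this factor with the ratio of the
    two peaks. *)
Lemma integrable_normal_sqr (t : R) : 0 < t ->
  (normal_prob 0 (Num.sqrt t)).-integrable [set: R] (fun z => (z ^+ 2)%:E).
Proof.
move=> t0; have st0 : Num.sqrt t != 0 by rewrite gt_eqF// sqrtr_gt0.
have st2 : Num.sqrt (t *+ 2) != 0 by rewrite gt_eqF// sqrtr_gt0 mulrn_wgt0.
have msq : measurable_fun [set: R] (fun z : R => (z ^+ 2)%:E).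
  exact/measurable_EFinP/measurable_funX.
apply/integrableP; split; first exact: msq.
under eq_integral do rewrite /= ger0_norm ?sqr_ge0//.
rewrite ge0_integral_normal_prob; last 2 first.
- exact: msq.
- by move=> z; rewrite lee_fin sqr_ge0.
set c := 4 * t * normal_peak (Num.sqrt t) / normal_peak (Num.sqrt (t *+ 2)).
have pk1 : 0 < normal_peak (Num.sqrt t) by rewrite normal_peak_gt0.
have pk2 : 0 < normal_peak (Num.sqrt (t *+ 2)) by rewrite normal_peak_gt0.
have c0 : 0 <= c by rewrite /c divr_ge0 ?(ltW pk2)// mulr_ge0 ?(ltW pk1)// mulr_ge0// ltW.
have mp s : measurable_fun [set: R] (fun z => (normal_pdf 0 s z)%:E).
  by apply/measurable_EFinP; exact: measurable_normal_pdf.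
apply: (@le_lt_trans _ _ (\int[leb]_z (c%:E * (normal_pdf 0 (Num.sqrt (t *+ 2)) z)%:E))%E).
  apply: ge0_le_integral => //.
  - by move=> z _; rewrite -EFinM lee_fin mulr_ge0 ?normal_pdf_ge0 ?sqr_ge0.
  - by apply: emeasurable_funM; [exact: msq|exact: mp].
  - by apply: emeasurable_funM; [exact: measurable_cst|exact: mp].
  move=> z _; rewrite -!EFinM lee_fin !normal_pdfE// /normal_fun !subr0.
  rewrite !sqr_sqrtr ?mulrn_wge0 ?(ltW t0)//.
  have -> : - z ^+ 2 / (t *+ 2) = - z ^+ 2 / (t *+ 2 *+ 2) + - (z ^+ 2 / (4 * t)).
    by field; rewrite gt_eqF.
  rewrite expRD; set e := expR (_ / (_ *+ 2 *+ 2)); set w := z ^+ 2 / (4 * t).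
  have zw : z ^+ 2 = 4 * t * w by rewrite /w; field; rewrite gt_eqF.
  (* [z ^ 2 exp(- z ^ 2 / (2 t)) <= 4 t exp(- z ^ 2 / (4 t))] *)
  have w1 : w * expR (- w) <= 1.
    rewrite expRN ler_pdivrMr ?expR_gt0// mul1r.
    by apply: le_trans (expR_ge1Dx w); rewrite lerDr.
  rewrite zw (_ : c * _ = (4 * t * normal_peak (Num.sqrt t) * e) * 1); last first.
    by rewrite /c; field; rewrite gt_eqF.
  rewrite (_ : _ * (_ * (e * _)) =
    (4 * t * normal_peak (Num.sqrt t) * e) * (w * expR (- w))); last by ring.
  by rewrite ler_wpM2l// !mulr_ge0 ?expR_ge0 ?(ltW t0) ?(ltW pk1).
rewrite ge0_integralZl//=; last by move=> z _; rewrite lee_fin normal_pdf_ge0.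
by rewrite integral_normal_pdf mule1 ltry.
all: exact: mp.
Qed.

(** By symmetry [x >= 0] may be assumed. Then [|z - x| = 2 max (z - x, 0) + (x - z)], where the
    second part has mean [x] and the first is given by the tail integral; the result is the closed
    formula of [g]. *)
Lemma integral_normal_dist (t x : R) : 0 < t ->
  (\int[normal_prob 0 (Num.sqrt t)]_z (`|z - x|)%:E = (`|x| + g t x)%:E)%E.
Proof.
move=> t0; have st0 : Num.sqrt t != 0 by rewrite gt_eqF// sqrtr_gt0.
wlog x0 : x / 0 <= x => [H|].
  have [|x0] := leP 0 x; first exact: H.
  rewrite -(@ge0_integral_normal_probN _ (fun z => (`|z - x|)%:E))//; last first.
    by apply/measurable_EFinP/measurableT_comp => //; exact: measurable_funB.
  have := H (- x); rewrite oppr_ge0 => /(_ (ltW x0)).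
  rewrite normrN /g sqrrN normrN => <-; apply: eq_integral => z _.
  by rewrite -normrN; congr (`|_|)%:E; ring.
have I1 := integrable_normal_id t0; have I0 := integral_normal_id t0.
have I := integral_normal_tail t0 x0.
have mm : measurable (`[x%R, +oo[%classic : set (measurableTypeR R)) by exact: measurable_itv.
have E0 : (\int[N t]_z (Num.max (z - x) 0)%:E = \int[N t]_(z in `[x%R, +oo[) (z - x)%:E)%E.
  rewrite [RHS]integral_mkcond; apply: eq_integral => z _.
  by rewrite /patch mem_setE in_itv/= andbT -subr_ge0; case: leP.
have mmax : measurable_fun [set: R] (fun z => (Num.max (z - x) 0)%:E).
  by apply/measurable_EFinP/measurable_maxr => //; exact: measurable_funB.
have Imax : (N t).-integrable [set: R] (fun z => (Num.max (z - x) 0)%:E).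
  apply/integrableP; split => //.
  under eq_integral do rewrite /= ger0_norm ?le_max ?lexx ?orbT//.
  by rewrite E0 I ltry.
have Ic : (N t).-integrable [set: R] (fun z => x%:E).
  exact: finite_measure_integrable_cst.
have -> : (\int[N t]_z (`|z - x|)%:E =
    \int[N t]_z (2%:E * (Num.max (z - x) 0)%:E + (x%:E - z%:E)))%E.
  apply: eq_integral => z _; rewrite -EFinM -EFinB -EFinD; congr EFin.
  by case: (leP 0 (z - x)) => zx; [rewrite ger0_norm//; ring|rewrite ltr0_norm//; ring].
rewrite integralD//; last 2 first.
- exact: integrableZl.
- exact: integrableB.
rewrite integralZl// integralB// I0 sube0 integral_cst//.
rewrite [X in (x%:E * X)%E](@probability_setT _ _ _ (N t)) mule1 E0 I.
rewrite -EFinM -EFinD; congr EFin.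
rewrite /g leNgt t0/= ger0_norm// normal_pdfE// /normal_fun subr0 /normal_peak.
rewrite sqr_sqrtr ?(ltW t0)//.
rewrite -(mulr_natl t 2); set e := expR _; set E := Erfc _.
have -> : Num.sqrt (2 * t / pi) = 2 * (t * (Num.sqrt (t * pi *+ 2))^-1) :> R.
  have pi0 := pi_gt0 R.
  have q0 : 0 < t * pi *+ 2 :> R by rewrite pmulrn_lgt0// mulr_gt0.
  apply/eqP; rewrite -(@eqrXn2 _ 2)// ?sqrtr_ge0//; last first.
    by rewrite !mulr_ge0 ?invr_ge0 ?sqrtr_ge0 ?(ltW t0).
  rewrite !exprMn exprVn !sqr_sqrtr ?(ltW q0)//; last first.
    by rewrite mulr_ge0 ?invr_ge0 ?(ltW pi0)// mulr_ge0 ?(ltW t0).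
  by apply/eqP; move: (pi : R) pi0 q0 => p pi0 q0; field; rewrite !gt_eqF.
by set K := (Num.sqrt (t * pi *+ 2))^-1; field.
Qed.

End Gaussian.

Lemma integral_probability_cst (R : realType) (d : measure_display)
    (T : measurableType d) (P : probability T R) (r : R) :
  (\int[P]_x r%:E = r%:E)%E.
Proof. by rewrite integral_cst// [X in (_ * X)%E](@probability_setT _ _ _ P) mule1. Qed.

(** * Markov property and martingales of Brownian motion *)

Section Independence.
Context (R : realType) (d : measure_display) (Omega : measurableType d).
Context (P : probability Omega R).
Context d1 d2 (T1 : measurableType d1) (T2 : measurableType d2).

(** Independence makes the joint law a product measure, since a product measure is determined by its
    values on rectangles; Tonelli's theorem then separates the variables. *)
Lemma ge0_integral_indep (X : {mfun Omega >-> T1}) (Y : {mfun Omega >-> T2})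
    (h : T1 * T2 -> \bar R) :
  (forall A C, measurable A -> measurable C ->
    P (X @^-1` A `&` Y @^-1` C) = (P (X @^-1` A) * P (Y @^-1` C))%E) ->
  measurable_fun [set: T1 * T2] h -> (forall z, (0 <= h z)%E) ->
  (\int[P]_w h (X w, Y w) = \int[P]_w \int[P]_w' h (X w, Y w'))%E.
Proof.
move=> indep mh h0.
have mXY : measurable_fun setT (fun w => (X w, Y w)) by exact: measurable_fun_pair.
pose XY : {mfun Omega >-> (T1 * T2)%type} :=
  HB.pack (fun w => (X w, Y w)) (isMeasurableFun.Build _ _ _ _ _ mXY).
transitivity (\int[distribution P XY]_z h z)%E.
  by rewrite ge0_integral_pushforward.
transitivity (\int[(distribution P X \x distribution P Y)%E]_z h z)%E.
  apply: eq_measure_integral => A mA _; apply/esym.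
  by apply: product_measure_unique => // C D mC mD; rewrite -indep.
rewrite fubini_tonelli1// ge0_integral_pushforward//; last 2 first.
- exact: measurable_fun_fubini_tonelli_F.
- by move=> x _; apply: integral_ge0 => y _; exact: h0.
apply: eq_integral => w _; rewrite /= /fubini_F ge0_integral_pushforward//.
exact: measurable_fun_pair2.
Qed.

End Independence.

Section BrownianMotion.
Context (R : realType) (d : measure_display) (Omega : measurableType d).
Context (P : probability Omega R) (B : R -> {RV P >-> R}).
Local Notation F := (natural_filtration B).

(** * The natural filtration and stopping times *)

Lemma natural_filtrationC t A : F t A -> F t (~` A).
Proof. by rewrite -setTD; exact: sigma_algebraCD. Qed.

Lemma natural_filtration_bigcup t (A : (set Omega)^nat) :
  (forall n, F t (A n)) -> F t (\bigcup_n A n).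
Proof. exact: sigma_algebra_bigcup. Qed.

Lemma natural_filtrationU t A C : F t A -> F t C -> F t (A `|` C).
Proof.
move=> FA FC; rewrite -bigcup2E; apply: natural_filtration_bigcup.
by move=> [|[|n]]//=; exact: sigma_algebra0.
Qed.

Lemma natural_filtrationI t A C : F t A -> F t C -> F t (A `&` C).
Proof.
move=> FA FC; rewrite -(setCK (A `&` C)) setCI; apply: natural_filtrationC.
by apply: natural_filtrationU; exact: natural_filtrationC.
Qed.

Lemma natural_filtrationD t A C : F t A -> F t C -> F t (A `\` C).
Proof.
by move=> FA FC; rewrite setDE; apply: natural_filtrationI => //; exact: natural_filtrationC.
Qed.

Lemma natural_filtration_le s t A : s <= t -> F s A -> F t A.
Proof.
move=> st; apply: sub_sigma_algebra2; apply: bigcup_subset => u/=.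
by rewrite !in_itv/= => /andP[-> /le_trans ->].
Qed.

Lemma natural_filtration_preimage t (A : set R) : 0 <= t -> measurable A ->
  F t (B t @^-1` A).
Proof.
move=> t0 mA; apply: sub_sigma_algebra; exists t; first by rewrite /= in_itv/= t0 lexx.
by exists A => //; rewrite setTI.
Qed.

Lemma natural_filtration_measurable t A : F t A -> measurable A.
Proof.
apply: smallest_sub; first exact: sigma_algebra_measurable.
by move=> C [u _ [D mD <-]]; rewrite setTI; exact: measurable_funPTI.
Qed.

(** The way from the right-continuous to the raw filtration: [tau < t] is a countable union of
    events [tau <= s] with [s < t], and the right filtration at such an [s] is contained in the
    natural filtration at [t]. The gaps are proportional to [t] so that every [s] is nonnegative. *)
Lemma stopping_time_lt tau t : stopping_time B tau -> 0 < t ->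
  F t [set w | (tau w < t%:E)%E].
Proof.
move=> [tau0 tauF] t0.
have -> : [set w | (tau w < t%:E)%E] =
    \bigcup_n [set w | (tau w <= (t - t / n.+1%:R)%:E)%E].
  apply/seteqP; split=> w /=.
    move=> wt; have fw : tau w \is a fin_num.
      by rewrite ge0_fin_numE// (lt_trans wt)// ltry.
    move: wt; rewrite -(fineK fw) lte_fin; set v := fine _ => vt.
    have tv : 0 < t - v by rewrite subr_gt0.
    (* This index makes [t / (n + 1)] at most [t - v]. *)
    exists (Num.truncn (t / (t - v))) => //=; rewrite -(fineK fw) lee_fin -/v lerBrDr -lerBrDl.
    by rewrite ler_pdivrMr// mulrC -ler_pdivrMr// ltW// truncnS_gt.
  move=> [n _ /=] /le_lt_trans; apply; rewrite lte_fin.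
  by rewrite ltrBlDr ltrDl divr_gt0.
apply: natural_filtration_bigcup => n.
have lt_t : t - t / n.+1%:R < t by rewrite ltrBlDr ltrDl divr_gt0.
have ge0 : 0 <= t - t / n.+1%:R.
  by rewrite subr_ge0 ler_piMr ?(ltW t0)// invf_le1// ler1n.
by apply: (tauF _ ge0); rewrite /= in_itv/= lt_t.
Qed.

Lemma stopping_time_ge tau t : stopping_time B tau -> 0 < t ->
  F t [set w | (t%:E <= tau w)%E].
Proof.
move=> st t0; have /natural_filtrationC := stopping_time_lt st t0.
by congr (F t); apply/seteqP; split=> w /=; rewrite leNgt => /negP.
Qed.

Lemma measurable_stopping_time tau : stopping_time B tau ->
  measurable_fun [set: Omega] tau.
Proof.
move=> st; apply: (measurability _ (ErealGenCInfty.measurableE R)) => //.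
move=> /= _ [_ [x ->] <-]; rewrite setTI.
have [x0|x0] := ltP 0 x; last first.
  rewrite (_ : _ @^-1` _ = setT)//; apply/seteqP; split => // w _ /=.
  rewrite in_itv/= andbT; apply: (@le_trans _ _ 0%E); first by rewrite lee_fin.
  by case: st.
have := natural_filtration_measurable (stopping_time_ge st x0).
by congr measurable; apply/seteqP; split => w /=; rewrite in_itv/= andbT.
Qed.

(** * Consequences of independent Gaussian increments *)

Context (hB : brownian_motion B).

(* Independence is applied to the identity of [Omega], seen as a map to [Omega]
   with the sigma-algebra [F v]. *)
Lemma ge0_markov v t E (h : R * R -> \bar R) : 0 <= v -> v < t -> F v E ->
  measurable_fun [set: R * R] h -> (forall z, (0 <= h z)%E) ->
  (\int[P]_(w in E) h (B v w, B t w - B v w)%R =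
   \int[P]_(w in E) \int[P]_w' h (B v w, B t w' - B v w')%R)%E.
Proof.
move=> v0 vt FE mh h0.
pose FT := g_sigma_algebraType
  (\bigcup_(u in `[0, v]) preimage_set_system setT (B u) measurable).
have mid : measurable_fun [set: Omega] (id : Omega -> FT).
  by move=> _ A mA; rewrite setTI; exact: natural_filtration_measurable mA.
pose X : {mfun Omega >-> FT} := HB.pack (id : Omega -> FT) (isMeasurableFun.Build _ _ _ _ _ mid).
pose Y : {mfun Omega >-> R} := [the {mfun Omega >-> R} of (B t - B v)%R].
have mB : measurable_fun [set: FT] (B v : FT -> R).
  by move=> _ A mA; rewrite setTI; exact: natural_filtration_preimage.
have mE : measurable (E : set FT) by [].
pose H (z : FT * R) : \bar R := ((\1_(E : set FT) z.1)%:E * h (B v z.1, z.2))%E.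
have mH : measurable_fun [set: FT * R] H.
  apply: emeasurable_funM.
    apply/measurable_EFinP; apply: measurableT_comp; last exact: measurable_fst.
    exact: measurable_indic.
  apply: measurableT_comp => //; apply: measurable_fun_pair.
    by apply: measurableT_comp => //; exact: measurable_fst.
  exact: measurable_snd.
have H0 z : (0 <= H z)%E by rewrite mule_ge0// lee_fin.
have indep A C : measurable A -> measurable C ->
    P (X @^-1` A `&` Y @^-1` C) = (P (X @^-1` A) * P (Y @^-1` C))%E.
  by move=> mA mC; exact: (bm_independent hB v0 vt).
have := @ge0_integral_indep _ _ _ P _ _ _ _ X Y H indep mH H0.
rewrite /H /= => IH; rewrite integral_mkcond [RHS]integral_mkcond.
transitivity (\int[P]_w ((\1_E w)%:E * h (B v w, B t w - B v w)%R))%E.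
  apply: eq_integral => w _; rewrite /patch indicE; case: ifPn => _.
    by rewrite mul1e.
  by rewrite mul0e.
rewrite IH; apply: eq_integral => w _; rewrite /patch indicE; case: ifPn => _.
  by apply: eq_integral => w' _; rewrite mul1e.
by under eq_integral do rewrite mul0e; rewrite integral0.
Qed.

Lemma ge0_integral_increment s t (f : R -> \bar R) : 0 <= s -> s < t ->
  measurable_fun [set: R] f -> (forall x, (0 <= f x)%E) ->
  (\int[P]_w f (B t w - B s w)%R = \int[normal_prob 0 (Num.sqrt (t - s))]_z f z)%E.
Proof.
move=> s0 st mf f0.
pose Y (w : Omega) : measurableTypeR R := B t w - B s w.
have mY : measurable_fun [set: Omega] Y by exact: measurable_funB.
transitivity (\int[pushforward P Y]_z f z)%E.
  by rewrite ge0_integral_pushforward.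
apply: eq_measure_integral => A mA _ /=.
by rewrite -(bm_gaussian hB s0 st).
Qed.

Lemma integrable_increment s t : 0 <= s -> s < t ->
  P.-integrable setT (fun w => (B t w - B s w)%:E).
Proof.
move=> s0 st; have ts : 0 < t - s by rewrite subr_gt0.
have mY : measurable_fun [set: Omega] (fun w => B t w - B s w).
  exact: measurable_funB.
apply/integrableP; split; first exact/measurable_EFinP.
rewrite (ge0_integral_increment (f := fun z => `|z%:E|%E))//; last first.
  by apply: measurableT_comp => //.
by have /integrableP[] := integrable_normal_id ts.
Qed.

Lemma integral_increment s t : 0 <= s -> s < t ->
  (\int[P]_w (B t w - B s w)%:E = 0)%E.
Proof.
move=> s0 st; have ts : 0 < t - s by rewrite subr_gt0.
rewrite -(integral_normal_id ts) integralE [in RHS]integralE.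
have mid : measurable_fun [set: R] (fun z : R => z%:E) by exact: EFin_measurable.
have := ge0_integral_increment s0 st (measurable_funepos mid) (fun z => funepos_ge0 _ z).
have := ge0_integral_increment s0 st (measurable_funeneg mid) (fun z => funeneg_ge0 _ z).
move=> <- <-; congr (_ - _)%E; apply: eq_integral => w _.
  by rewrite !funeposE.
by rewrite !funenegE.
Qed.

Lemma integrable_BM_sqr t : 0 <= t -> P.-integrable setT (fun w => (B t w ^+ 2)%:E).
Proof.
rewrite le_eqVlt => /predU1P[<-|t0].
  apply: (eq_integrable measurableT (fun=> 0%E)); last exact: integrable0.
  by move=> w _; rewrite (bm_start hB) expr0n.
apply/integrableP; split; first exact/measurable_EFinP/measurable_funX.
have := @ge0_integral_increment 0 t (fun z => `|(z ^+ 2)%:E|%E) (lexx 0) t0.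
under eq_integral do rewrite (bm_start hB) subr0.
move=> ->//; last by apply: measurableT_comp => //; exact/measurable_EFinP/measurable_funX.
by rewrite subr0; have /integrableP[] := integrable_normal_sqr t0.
Qed.

Lemma integrable_BM t : 0 <= t -> P.-integrable setT (fun w => (B t w)%:E).
Proof.
rewrite le_eqVlt => /predU1P[<-|t0].
  apply: (eq_integrable measurableT (fun=> 0%E)); last exact: integrable0.
  by move=> w _; rewrite (bm_start hB).
by apply: eq_integrable (integrable_increment (lexx 0) t0) => // w _; rewrite (bm_start hB) subr0.
Qed.

Lemma integral_BM_dist t x : 0 <= t ->
  (\int[P]_w (`|B t w - x|)%:E = (`|x| + g t x)%:E)%E.
Proof.
rewrite le_eqVlt => /predU1P[<-|t0].
  rewrite /g lexx addr0; under eq_integral do rewrite (bm_start hB) sub0r normrN.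
  by rewrite integral_probability_cst.
have := @ge0_integral_increment 0 t (fun z => (`|z - x|)%:E) (lexx 0) t0.
under eq_integral do rewrite (bm_start hB) subr0.
move=> ->//; first by rewrite subr0 integral_normal_dist.
by apply/measurable_EFinP/measurableT_comp => //; exact: measurable_funB.
Qed.

(** The Markov property is stated for nonnegative functions, so the increment is split into its
    positive and negative parts; independence from [E] gives them equal integrals over [E], because
    the increment is centred. *)
Lemma martingale_BM v t E : 0 <= v -> v <= t -> F v E ->
  (\int[P]_(w in E) (B t w)%:E = \int[P]_(w in E) (B v w)%:E)%E.
Proof.
move=> v0; rewrite le_eqVlt => /predU1P[<-//|vt] FE.
have mE := natural_filtration_measurable FE.
have t0 : 0 <= t by rewrite (le_trans v0)// ltW.
have intv := integrableS measurableT mE (subsetT _) (integrable_BM v0).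
have intt := integrableS measurableT mE (subsetT _) (integrable_BM t0).
have intD := integrableS measurableT mE (subsetT _) (integrable_increment v0 vt).
have mid : measurable_fun [set: R] (fun z : R => z%:E) by exact: EFin_measurable.
pose f w := (B t w - B v w)%:E.
have fI : P.-integrable setT f by exact: integrable_increment.
have mf : measurable_fun setT f by exact: measurable_int fI.
have cp : (\int[P]_w f^\+ w)%E \is a fin_num := integrable_pos_fin_num measurableT fI.
have cn : (\int[P]_w f^\- w)%E \is a fin_num := integrable_neg_fin_num measurableT fI.
have cpn : (\int[P]_w f^\+ w = \int[P]_w f^\- w)%E.
  have := integral_increment v0 vt; rewrite integralE -/f.
  rewrite -(fineK cp) -(fineK cn) -EFinB => -[] /eqP.
  by rewrite subr_eq0 => /eqP ->.
have Hp : (\int[P]_(w in E) f^\+ w = \int[P]_(w in E) \int[P]_w' f^\+ w')%E.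
  have H := @ge0_markov v t E (fun z => maxe (z.2)%:E 0%E) v0 vt FE.
  transitivity (\int[P]_(w in E) maxe (B t w - B v w)%:E 0)%E.
    by apply: eq_integral => w _; rewrite funeposE.
  rewrite H; last 2 first.
  - apply: measurable_maxe => //; apply/measurable_EFinP; exact: measurable_snd.
  - by move=> z; rewrite le_max lexx orbT.
  by apply: eq_integral => w _; apply: eq_integral => w' _; rewrite funeposE.
have Hn : (\int[P]_(w in E) f^\- w = \int[P]_(w in E) \int[P]_w' f^\- w')%E.
  have H := @ge0_markov v t E (fun z => maxe (- (z.2)%:E) 0)%E v0 vt FE.
  transitivity (\int[P]_(w in E) maxe (- (B t w - B v w)%:E) 0)%E.
    by apply: eq_integral => w _; rewrite funenegE.
  rewrite H; last 2 first.
  - apply: measurable_maxe => //; apply: measurableT_comp => //.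
    apply/measurable_EFinP; exact: measurable_snd.
  - by move=> z; rewrite le_max lexx orbT.
  by apply: eq_integral => w _; apply: eq_integral => w' _; rewrite funenegE.
have E0 : (\int[P]_(w in E) f w = 0)%E.
  rewrite integralE Hp Hn cpn -(fineK cn) subee// integral_cst//.
  by rewrite fin_numM// fin_num_measure.
have : (\int[P]_(w in E) f w = \int[P]_(w in E) (B t w)%:E - \int[P]_(w in E) (B v w)%:E)%E.
  by rewrite -integralB//; apply: eq_integral => w _; rewrite /f EFinB.
have ft := integrable_fin_num mE intt.
have fv := integrable_fin_num mE intv.
rewrite E0 -(fineK ft) -(fineK fv) -EFinB => -[] /esym/eqP.
by rewrite subr_eq0 => /eqP ->.
Qed.

(** Given the past up to [v], [B t - x] is a centred Gaussian of variance [t - v] shifted by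
    [B v - x], and [g] gives the mean of its absolute value. With [t] fixed, this is the martingale
    property of [|B v - x| + g (t - v) (x - B v)], compared with its terminal value. *)
Lemma martingale_BM_dist x v t E : 0 <= v -> v <= t -> F v E ->
  (\int[P]_(w in E) (`|B t w - x|)%:E =
   \int[P]_(w in E) (`|B v w - x| + g (t - v) (x - B v w))%:E)%E.
Proof.
move=> v0; rewrite le_eqVlt => /predU1P[<-|vt] FE.
  by apply: eq_integral => w _; rewrite subrr /g lexx addr0.
have tv : 0 < t - v by rewrite subr_gt0.
have := @ge0_markov v t E (fun z => (`|z.1 + z.2 - x|)%:E) v0 vt FE.
under eq_integral do rewrite /= (addrC (B v _)) subrK.
move=> ->; last 2 first.
- apply/measurable_EFinP/measurableT_comp => //; apply: measurable_funB => //.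
  by apply: measurable_funD; [exact: measurable_fst|exact: measurable_snd].
- by [].
apply: eq_integral => w _ /=.
rewrite (ge0_integral_increment (f := fun z => (`|B v w + z - x|)%:E))//; last first.
  apply/measurable_EFinP/measurableT_comp => //; apply: measurable_funB => //.
  exact: measurable_funD.
rewrite -(normrN (B v w - x)) opprB -integral_normal_dist//.
by apply: eq_integral => z _; congr (`|_|)%:E; ring.
Qed.

(** The cross term vanishes in the mean and the square of the increment only adds. In optional
    stopping this bounds the second moments of all discretised values by one terminal quantity. *)
Lemma submartingale_BM_sqr v t E : 0 <= v -> v <= t -> F v E ->
  (\int[P]_(w in E) (B v w ^+ 2)%:E <= \int[P]_(w in E) (B t w ^+ 2)%:E)%E.
Proof.
move=> v0; rewrite le_eqVlt => /predU1P[<-//|vt] FE.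
have := @ge0_markov v t E (fun z => ((z.1 + z.2) ^+ 2)%:E) v0 vt FE.
under eq_integral do rewrite /= (addrC (B v _)) subrK.
have mh : measurable_fun [set: R * R] (fun z : R * R => ((z.1 + z.2) ^+ 2)%:E).
  apply/measurable_EFinP/measurable_funX/measurable_funD.
    exact: measurable_fst.
  exact: measurable_snd.
move=> ->//; last by move=> z; rewrite lee_fin sqr_ge0.
have mE := natural_filtration_measurable FE.
have intD := integrable_increment v0 vt.
have intQ : P.-integrable setT (fun w => ((B t w - B v w) ^+ 2)%:E).
  apply/integrableP; split.
    by apply/measurable_EFinP/measurable_funX; exact: measurable_funB.
  rewrite (ge0_integral_increment (f := fun z => `|(z ^+ 2)%:E|%E))//; last first.
    by apply: measurableT_comp => //; exact/measurable_EFinP/measurable_funX.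
  have tv : 0 < t - v by rewrite subr_gt0.
  by have /integrableP[] := integrable_normal_sqr tv.
have fc := integrable_fin_num measurableT intQ.
have c0 : (0 <= \int[P]_w ((B t w - B v w) ^+ 2)%:E)%E.
  by apply: integral_ge0 => w _; rewrite lee_fin sqr_ge0.
apply: (@le_trans _ _ (\int[P]_(w in E)
    ((B v w ^+ 2)%:E + \int[P]_w' ((B t w' - B v w') ^+ 2)%:E))%E).
  apply: ge0_le_integral => //.
  - by move=> w _; rewrite lee_fin sqr_ge0.
  - by apply/measurable_EFinP/measurable_funX/measurable_funTS.
  - by apply: emeasurable_funD => //; apply/measurable_EFinP/measurable_funX/measurable_funTS.
  - by move=> w _; rewrite leeDl.
rewrite le_eqVlt; apply/orP; left; apply/eqP; apply: eq_integral => w _ /=.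
have intZ : P.-integrable setT (fun w' => (2 * B v w)%:E * (B t w' - B v w')%:E)%E.
  exact: integrableZl.
have intC : P.-integrable setT (fun w' : Omega => (B v w ^+ 2)%:E).
  exact: finite_measure_integrable_cst.
transitivity (\int[P]_w' (((B v w ^+ 2)%:E +
    (2 * B v w)%:E * (B t w' - B v w')%:E) + ((B t w' - B v w') ^+ 2)%:E))%E.
  rewrite integralD//; last exact: integrableD.
  rewrite integralD//; congr (_ + _)%E.
  by rewrite integral_probability_cst integralZl// integral_increment// mule0 adde0.
by apply: eq_integral => w' _; rewrite -!EFinM -!EFinD; congr EFin; ring.
Qed.

End BrownianMotion.

(** * Limits of integrals *)

Section Convergence.
Context (R : realType) (d : measure_display) (T : measurableType d).
Context (P : probability T R) (D : set T) (mD : measurable D).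

Lemma le_integral_fatou (f_ : (T -> \bar R)^nat) (f : T -> \bar R) (b : \bar R) :
  (forall n, measurable_fun D (f_ n)) -> (forall n x, D x -> (0 <= f_ n x)%E) ->
  (forall x, D x -> f_ n x @[n --> \oo] --> f x) ->
  (forall n, (\int[P]_(x in D) f_ n x <= b)%E) ->
  (\int[P]_(x in D) f x <= b)%E.
Proof.
move=> mf f0 cf fb; apply: (@le_trans _ _ (\int[P]_(x in D) limn_einf (f_ ^~ x))%E).
  rewrite le_eqVlt; apply/orP; left; apply/eqP; apply: eq_integral => x /[!inE] Dx.
  rewrite is_cvg_limn_einfE; first by apply/esym/cvg_lim => //; exact: cf.
  by apply/cvg_ex; exists (f x); exact: cf.
apply: le_trans (fatou P mD mf f0) _.
rewrite limn_einf_lim; apply: lime_le; first exact: is_cvg_einfs.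
apply: nearW => n; apply: le_trans (fb n).
by apply: ereal_inf_lbound; exists n => /=.
Qed.

(* Fatou's lemma applied to [k Y ^ 2 +- Y + 1 / (4 k) = k (Y +- 1 / (2 k)) ^ 2 >= 0],
   with [k] tending to 0. *)
Lemma integral_cvg_sqr_bounded (X_ : nat -> T -> R) (X : T -> R) (c K : R) :
  (forall n, measurable_fun D (X_ n)) ->
  (forall x, D x -> X_ n x @[n --> \oo] --> X x) ->
  (forall n, (\int[P]_(x in D) (X_ n x)%:E = c%:E)%E) ->
  (forall n, (\int[P]_(x in D) (X_ n x ^+ 2)%:E <= K%:E)%E) ->
  P.-integrable D (EFin \o X) /\ (\int[P]_(x in D) (X x)%:E = c%:E)%E.
Proof.
move=> mX cX Xc XK.
have mX0 : measurable_fun D X.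
  by apply: (measurable_fun_cvg (h := X_)) => // x Dx; exact: cX.
have sqr_int (Y : T -> R) : measurable_fun D Y ->
    (\int[P]_(x in D) (Y x ^+ 2)%:E <= K%:E)%E ->
    P.-integrable D (fun x => (Y x ^+ 2)%:E) /\ P.-integrable D (EFin \o Y).
  move=> mY YK.
  have I2 : P.-integrable D (fun x => (Y x ^+ 2)%:E).
    apply/integrableP; split; first exact/measurable_EFinP/measurable_funX.
    under eq_integral do rewrite /= ger0_norm ?sqr_ge0//.
    by rewrite (le_lt_trans YK)// ltry.
  split=> //; apply: (@le_integrable _ _ _ _ _ mD _ (fun x => 1%:E + (Y x ^+ 2)%:E)%E) => //.
  - exact/measurable_EFinP.
  - move=> x Dx; rewrite -EFinD lee_fin /= [leRHS]ger0_norm ?addr_ge0 ?sqr_ge0//.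
    by have := sqr_ge0 (`|Y x| - 1); rewrite -(real_normK (num_real (Y x))); nra.
  - by apply: integrableD => //; exact: finite_measure_integrable_cst.
have X2K : (\int[P]_(x in D) (X x ^+ 2)%:E <= K%:E)%E.
  apply: (@le_integral_fatou (fun n x => (X_ n x ^+ 2)%:E)) => //.
  - by move=> n; exact/measurable_EFinP/measurable_funX.
  - by move=> n x _; rewrite lee_fin sqr_ge0.
  - by move=> x Dx; apply: cvg_EFin; [exact: nearW|]; apply: (cvgM (cX x Dx) (cX x Dx)).
have [I2 I1] := sqr_int X mX0 X2K.
split=> //.
have fI := integrable_fin_num mD I1.
have main (s : R) : `|s| = 1 -> s * fine (\int[P]_(x in D) (X x)%:E)%E <= s * c.
  move=> s1; have s2 : s ^+ 2 = 1 by rewrite -real_normK ?num_real// s1 expr1n.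
  apply/ler_addgt0Pr => e e0.
  have K0 : 0 <= K.
    by rewrite -lee_fin; apply: le_trans X2K; apply: integral_ge0 => x _; rewrite lee_fin sqr_ge0.
  (* This gives [k * K <= e]; the summand 1 prevents a division by zero when [K = 0]. *)
  pose k := e / (K + 1).
  have k0 : 0 < k by rewrite divr_gt0// ltr_wpDl.
  have kK : k * K <= e.
    by rewrite /k mulrAC ler_pdivrMr ?ltr_wpDl// ler_pM2l// lerDl.
  pose Z (Y : T -> R) x := k * (Y x ^+ 2) + s * Y x + (4 * k)^-1.
  have Z0 Y x : 0 <= Z Y x.
    have -> : Z Y x = k * (s * Y x + (2 * k)^-1) ^+ 2.
      by rewrite /Z sqrrD exprMn s2; field; rewrite gt_eqF.
    by rewrite mulr_ge0 ?sqr_ge0 ?ltW.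
  have mZ (Y : T -> R) : measurable_fun D Y -> measurable_fun D (EFin \o Z Y).
    move=> mY; apply/measurable_EFinP/measurable_funD => //; apply: measurable_funD.
      by apply: measurable_funM => //; exact: measurable_funX.
    exact: measurable_funM.
  have ZE (Y : T -> R) : measurable_fun D Y -> (\int[P]_(x in D) (Y x ^+ 2)%:E <= K%:E)%E ->
      (\int[P]_(x in D) (Z Y x)%:E = k%:E * (\int[P]_(x in D) (Y x ^+ 2)%:E)
        + s%:E * (\int[P]_(x in D) (Y x)%:E) + (\int[P]_(x in D) ((4 * k)^-1)%:E))%E.
    move=> mY YK; have [J2 J1] := sqr_int Y mY YK.
    have J3 : P.-integrable D (fun x => k%:E * (Y x ^+ 2)%:E)%E by exact: integrableZl.
    have J4 : P.-integrable D (fun x => s%:E * (Y x)%:E)%E by exact: integrableZl.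
    have J5 : P.-integrable D (fun x => ((4 * k)^-1)%:E) by exact: finite_measure_integrable_cst.
    transitivity (\int[P]_(x in D) ((k%:E * (Y x ^+ 2)%:E + s%:E * (Y x)%:E) + ((4 * k)^-1)%:E))%E.
      by apply: eq_integral => x _; rewrite -!EFinM -!EFinD.
    rewrite integralD//; last exact: integrableD.
    by rewrite integralD// !integralZl.
  have pD : (\int[P]_(x in D) ((4 * k)^-1)%:E)%E \is a fin_num.
    by rewrite integral_cst// fin_numM// fin_num_measure.
  have : (\int[P]_(x in D) (Z X x)%:E <=
      (k * K + s * c + fine (\int[P]_(x in D) ((4 * k)^-1)%:E))%:E)%E.
    apply: (@le_integral_fatou (fun n x => (Z (X_ n) x)%:E)).
    - by move=> n; exact: mZ.
    - by move=> n x _; rewrite lee_fin.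
    - move=> x Dx; apply: cvg_EFin; [exact: nearW|]; apply: cvgD; last exact: cvg_cst.
      apply: cvgD; last by apply: cvgM; [exact: cvg_cst|exact: cX].
      by apply: cvgM; [exact: cvg_cst|]; apply: (cvgM (cX x Dx) (cX x Dx)).
    - move=> n; rewrite ZE// !EFinD fineK//; apply: leeD2r.
      rewrite Xc -EFinM; apply: leeD2r.
      by rewrite (EFinM k K) lee_pmul2l// lte_fin.
  rewrite ZE// -{1}(fineK pD) -(fineK fI) -EFinM.
  have f2 := integrable_fin_num mD I2.
  rewrite -(fineK f2) -EFinM -!EFinD lee_fin lerD2r => H.
  have X20 : 0 <= k * fine (\int[P]_(x in D) (X x ^+ 2)%:E).
    by rewrite mulr_ge0 ?(ltW k0)// fine_ge0//; apply: integral_ge0 => x _; rewrite lee_fin sqr_ge0.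
  by lra.
rewrite -(fineK fI); congr EFin; apply/eqP; rewrite eq_le.
have := main 1; rewrite normr1 !mul1r => -> //=.
by have := main (-1); rewrite normrN1 !mulN1r lerN2 => ->.
Qed.

(** In optional stopping [kappa] is the index of the grid cell containing the stopping time: the
    integral of a value at a random grid time becomes a finite sum of integrals at deterministic
    times. *)
Lemma integral_partition_nat (N : nat) (kappa : T -> nat) (f : nat -> T -> R) :
  (forall k, measurable (D `&` [set x | kappa x = k])) ->
  (forall x, D x -> (kappa x < N)%N) ->
  (forall k, measurable_fun setT (f k)) ->
  measurable_fun D (fun x => f (kappa x) x) /\
  (\int[P]_(x in D) (f (kappa x) x)%:E =
   \sum_(0 <= k < N) \int[P]_(x in D `&` [set x | kappa x = k]) (f k x)%:E)%E.
Proof.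
move=> mk kN mf.
have DE : D = \bigcup_k (D `&` [set x | kappa x = k]).
  by apply/seteqP; split=> [x Dx|x [k _ []]//]; exists (kappa x).
have mfk : measurable_fun D (fun x => f (kappa x) x).
  rewrite DE; apply/measurable_fun_bigcup => // k.
  apply: (eq_measurable_fun (f k)); last exact: measurable_funTS.
  by move=> x; rewrite inE => -[_ /= ->].
split=> //.
have DE' : D = \big[setU/set0]_(k <- index_iota 0 N) (D `&` [set x | kappa x = k]).
  rewrite -bigcup_seq; apply/seteqP; split=> [x Dx|x [k _ []]//].
  by exists (kappa x) => //=; rewrite mem_index_iota/= kN.
rewrite {1}DE' integral_bigsetU_EFin//.
- apply: eq_bigr => k _; apply: eq_integral => x; rewrite inE => -[_ /= ->//].
- exact: iota_uniq.
- apply/trivIsetP => i j _ _ ij; apply/seteqP; split => // x [[_ /= xi] [_ /= xj]].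
  by move: ij; rewrite -xi -xj eqxx.
- by rewrite -DE'; exact/measurable_EFinP.
Qed.

End Convergence.

(** * Regularity of g *)

Section LocalTimeMean.
Context (R : realType).

Lemma Erfc_ge0 (z : R) : 0 <= Erfc z.
Proof.
rewrite /Erfc mulr_ge0 ?divr_ge0 ?sqrtr_ge0//.
by apply: Rintegral_ge0 => v _; exact: expR_ge0.
Qed.

Lemma g_t0 (t : R) : 0 <= t -> g t 0 = Num.sqrt (2 * t / pi).
Proof.
rewrite le_eqVlt => /predU1P[<-|t0]; first by rewrite /g lexx mulr0 mul0r sqrtr0.
by rewrite /g leNgt t0/= normr0 mul0r subr0 expr0n/= oppr0 mul0r expR0 mulr1.
Qed.

Lemma g_le (t x : R) : 0 <= t -> g t x <= Num.sqrt (2 * t / pi).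
Proof.
rewrite le_eqVlt => /predU1P[<-|t0]; first by rewrite /g lexx mulr0 mul0r sqrtr0.
rewrite /g (leNgt t 0) t0/= lerBlDr; apply: ler_wpDr; first by rewrite mulr_ge0 ?Erfc_ge0.
rewrite ler_piMr ?sqrtr_ge0// -expR0 ler_expR mulNr oppr_le0.
by rewrite mulr_ge0 ?sqr_ge0// invr_ge0 mulr_ge0// ltW.
Qed.

(** Monotonicity serves to make [Erfc], and with it [g], measurable. *)
Lemma Erfc_nonincreasing : nonincreasing_fun (@Erfc R).
Proof.
move=> x y xy; rewrite /Erfc ler_pM2l; last first.
  by rewrite divr_gt0 ?sqrtr_gt0 ?pi_gt0.
have mf : measurable_fun [set: measurableTypeR R] (fun v : R => (expR (- v ^+ 2))%:E).
  by apply/measurable_EFinP; exact: measurable_gauss_fun.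
have fin z : (\int[@lebesgue_measure R]_(v in `[z, +oo[) (expR (- v ^+ 2))%:E)%E \is a fin_num.
  rewrite ge0_fin_numE; last by apply: integral_ge0 => v _; rewrite lee_fin expR_ge0.
  apply: (@le_lt_trans _ _ (\int[@lebesgue_measure R]_v (gauss_fun v)%:E)%E).
    by apply: ge0_subset_integral => // v _; rewrite lee_fin expR_ge0.
  by rewrite integralT_gauss ltry.
apply: fine_le => //.
apply: ge0_subset_integral => //.
- exact: measurable_funTS.
- by apply: subset_itvr; rewrite bnd_simp.
Qed.

Lemma measurable_g (d : measure_display) (T : measurableType d) (D : set T)
    (S Y : T -> R) : measurable D ->
  measurable_fun D S -> measurable_fun D Y -> measurable_fun D (fun w => g (S w) (Y w)).
Proof.
move=> mD mS mY.
(* For [0 < S w] an inverse is the power of exponent [-1], and [powR] is measurable on the whole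
   line. *)
have -> : (fun w => g (S w) (Y w)) = (fun w => if S w <= 0 then 0 else
  Num.sqrt (2 * S w / pi) * expR (- Y w ^+ 2 * (powR (2 * S w) (-1)))
  - `|Y w| * Erfc (`|Y w| * powR (Num.sqrt (2 * S w)) (-1))).
  apply/funext => w; rewrite /g; case: leP => // S0.
  by rewrite !powR_inv1 ?sqrtr_ge0// mulr_ge0// ltW.
have mS2 : measurable_fun D (fun w => 2 * S w) by exact: measurable_funM.
have msqrt (f : T -> R) : measurable_fun D f -> measurable_fun D (fun w => Num.sqrt (f w)).
  move=> mf; apply: measurableT_comp => //.
  by apply: continuous_measurable_fun; exact: sqrt_continuous.
have mnY : measurable_fun D (fun w => `|Y w|) by exact: measurableT_comp.
apply: measurable_fun_if => //; first exact: measurable_fun_ler.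
apply: (measurable_funS mD); first exact: subIsetl.
apply: measurable_funB.
  apply: measurable_funM; first by apply: msqrt; exact: measurable_funM.
  apply: measurableT_comp => //; apply: measurable_funM.
    by apply: measurable_funN; exact: measurable_funX.
  exact: (measurableT_comp (measurable_powR _)).
apply: measurable_funM => //.
apply: (measurableT_comp (nonincreasing_measurable measurableT Erfc_nonincreasing)).
apply: measurable_funM => //.
by apply: (measurableT_comp (measurable_powR _)); exact: msqrt.
Qed.

End LocalTimeMean.

(** * Path continuity, and the sign and continuity of [g] obtained from Brownian motion *)

Section Paths.
Context (R : realType) (d : measure_display) (Omega : measurableType d).
Context (P : probability Omega R) (B : R -> {RV P >-> R}) (hB : brownian_motion B).
Local Notation F := (natural_filtration B).

Lemma cvg_path w (v : R) (v_ : nat -> R) : 0 <= v -> (forall n, 0 <= v_ n) ->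
  v_ n @[n --> \oo] --> v -> B (v_ n) w @[n --> \oo] --> B v w.
Proof.
move=> v0 v_0 cv.
have /subspace_continuousP/(_ v) := @bm_continuous _ _ _ _ _ hB w.
rewrite /= in_itv/= v0 => /(_ isT) H.
apply: (cvg_comp v_ (fun t => B t w) _ H).
move=> U /= HU; have := cv _ HU; rewrite !nbhs_simpl/=. apply: filterS => n /=; apply.
by rewrite /= in_itv/= v_0.
Qed.

Lemma path_IVT w (a b y : R) : 0 <= a -> a <= b ->
  Num.min (B a w) (B b w) <= y <= Num.max (B a w) (B b w) ->
  exists2 t, t \in `[a, b] & B t w = y.
Proof.
move=> a0 ab; apply: (IVT ab).
apply: continuous_subspaceW (@bm_continuous _ _ _ _ _ hB w).
by apply: subset_itv; rewrite bnd_simp.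
Qed.

Lemma integral_abs_increment a b : 0 <= a -> 0 <= b ->
  (\int[P]_w (`|B a w - B b w|)%:E = (g `|a - b| 0)%:E)%E.
Proof.
wlog ab : a b / b <= a => [H a0 b0|a0 b0].
  have [|ba] := leP b a; first by move=> /H; exact.
  rewrite distrC -H//; last exact: ltW.
  by apply: eq_integral => w _; rewrite distrC.
move: ab; rewrite le_eqVlt => /predU1P[->|ab].
  rewrite subrr normr0 /g lexx; under eq_integral do rewrite subrr normr0.
  by rewrite integral0.
have ab0 : 0 < a - b by rewrite subr_gt0.
rewrite (ge0_integral_increment hB (f := fun z => (`|z|)%:E))//; last first.
  by apply/measurable_EFinP; exact: normr_measurable.
under eq_integral do rewrite -[X in `|X|]subr0.
by rewrite integral_normal_dist// normr0 add0r gtr0_norm.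
Qed.

(** Coupling along one Brownian path: [g a z + |z|] is [E|B_a - z|], and changing the time costs at
    most [E|B_a - B_b| = sqrt (2 |a - b| / pi)]. The point [z] enters both in [|B_a - z|] and in
    [|z|], whence the factor 2. *)
Lemma g_lip (s s' z z' : R) :
  g s z <= g s' z' + (2 * `|z - z'| + Num.sqrt (2 * `|s - s'| / pi)).
Proof.
(* [g] vanishes at nonpositive times, so times may be truncated at 0, which brings them into the
   range of [brownian_motion] and does not increase their distance. *)
have g_max (t x : R) : g t x = g (Num.max t 0) x.
  by rewrite /g; case: (leP t 0) => // t0; rewrite ?lexx// (leNgt t 0) t0.
pose a := Num.max s 0; pose b := Num.max s' 0.
have a0 : 0 <= a by rewrite le_max lexx orbT.
have b0 : 0 <= b by rewrite le_max lexx orbT.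
have ab : `|a - b| <= `|s - s'|.
  have c1 := ler_norm (s - s'); have := ler_norm (s' - s); rewrite distrC => c2.
  rewrite ler_norml /a /b.
  by case: (leP s 0) => ?; case: (leP s' 0) => ?; apply/andP; split; lra.
have mB c x : measurable_fun setT (fun w => (`|B c w - x|)%:E).
  by apply/measurable_EFinP/measurableT_comp => //; exact: measurable_funB.
have : (\int[P]_w (`|B a w - z|)%:E <=
   \int[P]_w ((`|B b w - z'|)%:E + (`|B a w - B b w|)%:E + (`|z - z'|)%:E))%E.
  apply: ge0_le_integral => //.
  - apply: emeasurable_funD => //; apply: emeasurable_funD => //.
    by apply/measurable_EFinP/measurableT_comp => //; exact: measurable_funB.
  - move=> w _; rewrite -!EFinD lee_fin.
    have -> : B a w - z = (B b w - z') + (B a w - B b w) - (z - z') by ring.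
    by apply: le_trans (ler_normB _ _) _; rewrite lerD2r ler_normD.
have mab : measurable_fun setT (fun w => (`|B a w - B b w|)%:E).
  by apply/measurable_EFinP/measurableT_comp => //; exact: measurable_funB.
have msum : measurable_fun setT (fun w => (`|B b w - z'|)%:E + (`|B a w - B b w|)%:E)%E.
  exact: emeasurable_funD.
rewrite ge0_integralD//; last by move=> w _; exact: adde_ge0.
rewrite ge0_integralD//.
rewrite integral_probability_cst !integral_BM_dist// integral_abs_increment//.
rewrite -!EFinD lee_fin -!g_max g_t0// => H.
have : Num.sqrt (2 * `|a - b| / pi) <= Num.sqrt (2 * `|s - s'| / pi).
  rewrite ler_sqrt; last by rewrite mulr_ge0 ?invr_ge0 ?pi_ge0// mulr_ge0.
  by rewrite ler_pM2r ?invr_gt0 ?pi_gt0// ler_pM2l.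
have : `|z'| - `|z| <= `|z - z'| by rewrite -(distrC z'); exact: lerB_dist.
by lra.
Qed.

(** Jensen's inequality: [|x| = |E[B_t - x]| <= E|B_t - x| = |x| + g t x]. *)
Lemma g_ge0 (t x : R) : 0 <= g t x.
Proof.
have [t0|t0] := leP t 0; first by rewrite /g t0.
have := integral_BM_dist hB x (ltW t0).
have I := integrable_BM hB (ltW t0).
have : (\int[P]_w (B t w)%:E = 0)%E.
  have := integral_increment hB (lexx 0) t0.
  by under eq_integral do rewrite (bm_start hB) subr0.
move=> I0 I1.
have IB : P.-integrable setT (fun w => (B t w - x)%:E).
  rewrite (_ : (fun _ => _) = (fun w => (B t w)%:E - x%:E)%E).
    by apply: integrableB => //; exact: finite_measure_integrable_cst.
  by apply/funext => w; rewrite EFinB.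
have := le_abse_integral P measurableT (measurable_int _ IB).
under [X in (_ <= X)%E -> _]eq_integral do rewrite /=.
rewrite I1.
have -> : (\int[P]_w (B t w - x)%:E = (- x)%:E)%E.
  under eq_integral do rewrite EFinB.
  rewrite integralB//; last exact: finite_measure_integrable_cst.
  by rewrite I0 integral_probability_cst sub0e.
by rewrite lee_fin normrN lerDl.
Qed.

Lemma g_cvg (s_ z_ : nat -> R) (s z : R) :
  s_ n @[n --> \oo] --> s -> z_ n @[n --> \oo] --> z ->
  g (s_ n) (z_ n) @[n --> \oo] --> g s z.
Proof.
move=> cs cz.
pose e n := 2 * `|z_ n - z| + Num.sqrt (2 * `|s_ n - s| / pi).
have ce : e n @[n --> \oo] --> 0.
  rewrite -[X in _ --> X]addr0; apply: cvgD.
    rewrite -[X in _ --> X](mulr0 2); apply: cvgM; first exact: cvg_cst.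
    rewrite -(@normr0 _ R); apply: cvg_norm; rewrite -(subrr z).
    by apply: cvgB => //; exact: cvg_cst.
  have cq : 2 * `|s_ n - s| / pi @[n --> \oo] --> (0 : R).
    rewrite -[X in _ --> X](mul0r (pi^-1)); apply: cvgM; last exact: cvg_cst.
    rewrite -[X in _ --> X](mulr0 2); apply: cvgM; first exact: cvg_cst.
    rewrite -(@normr0 _ R); apply: cvg_norm; rewrite -(subrr s).
    by apply: cvgB => //; exact: cvg_cst.
  rewrite -[X in _ --> X](@sqrtr0 R).
  by apply: (cvg_comp _ (@Num.sqrt R) cq); exact: sqrt_continuous.
have H n : g s z - e n <= g (s_ n) (z_ n) <= g s z + e n.
  rewrite lerBlDr g_lip andbT.
  by apply: le_trans (g_lip s (s_ n) z (z_ n)) _; rewrite lerD2l (distrC z) (distrC s).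
apply: (@squeeze_cvgr _ _ _ _ (fun n => g s z - e n) (fun n => g s z + e n)).
- exact: nearW.
- by rewrite -[X in _ --> X]subr0; apply: cvgB => //; exact: cvg_cst.
- by rewrite -[X in _ --> X]addr0; apply: cvgD => //; exact: cvg_cst.
Qed.

End Paths.

(** * Optional stopping *)

Section OptionalStopping.
Context (R : realType) (d : measure_display) (Omega : measurableType d).
Context (P : probability Omega R) (B : R -> {RV P >-> R}) (hB : brownian_motion B).
Local Notation F := (natural_filtration B).

(* [tau] is approximated from above by the first point of a finite grid that is
   strictly larger: this discretisation is a stopping time of the raw filtration,
   and the squares of the stopped values are bounded in L1. *)
Lemma optional_stopping (tau : Omega -> \bar R) (t : R) (A : set Omega)
    (M : R -> R -> R) (C : R) :
  stopping_time B tau -> 0 < t ->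
  (forall v, 0 < v -> v <= t -> F v (A `&` [set w | (tau w < v%:E)%E])) ->
  (forall v, measurable_fun setT (M v)) ->
  (forall (v_ y_ : nat -> R) v y, v_ n @[n --> \oo] --> v ->
    y_ n @[n --> \oo] --> y -> M (v_ n) (y_ n) @[n --> \oo] --> M v y) ->
  (forall v y, 0 <= v -> v <= t -> `|M v y| <= C * (1 + `|y|)) ->
  (forall v E, 0 <= v -> v <= t -> F v E ->
    (\int[P]_(w in E) (M t (B t w))%:E = \int[P]_(w in E) (M v (B v w))%:E)%E) ->
  P.-integrable (A `&` [set w | (tau w < t%:E)%E])
    (fun w => (M (fine (tau w)) (stopped_value B tau w))%:E) /\
  (\int[P]_(w in A `&` [set w | (tau w < t%:E)%E])
     (M (fine (tau w)) (stopped_value B tau w))%:E =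
   \int[P]_(w in A `&` [set w | (tau w < t%:E)%E]) (M t (B t w))%:E)%E.
Proof.
move=> st t0 AF mM cM gM martM.
set D := A `&` _.
have mD : measurable D by apply: natural_filtration_measurable (AF t t0 (lexx t)).
have tau_fin w : D w -> [/\ (tau w = (fine (tau w))%:E), 0 <= fine (tau w) & fine (tau w) < t].
  move=> [_ /= wt]; have tau0 := st.1 w.
  have fw : tau w \is a fin_num by rewrite ge0_fin_numE// (lt_trans wt)// ltry.
  by rewrite -lee_fin -lte_fin fineK.
(* The cell of index [k] is closed at [grid n k] and open at [grid n k.+1]. The discretised time is
   the right endpoint of the cell containing [tau w], hence strictly larger than [tau w]. *)
pose kappa n w := Num.truncn (fine (tau w) * n.+1%:R / t).
pose grid n k : R := t * k%:R / n.+1%:R.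
have n0 n : 0 < n.+1%:R :> R by [].
have kappaE n w k : D w -> (kappa n w = k) <->
    (grid n k <= fine (tau w)) && (fine (tau w) < grid n k.+1).
  move=> /tau_fin[_ v0 _]; rewrite /kappa /grid; set v := fine (tau w) in v0 *.
  have x0 : 0 <= v * n.+1%:R / t by rewrite divr_ge0 ?mulr_ge0 ?(ltW t0).
  rewrite ler_pdivrMr// (mulrC t k%:R) -ler_pdivlMr//.
  rewrite ltr_pdivlMr// (mulrC t k.+1%:R) -ltr_pdivrMr//.
  split=> [<-|/andP[h1 h2]]; first exact: truncn_itv.
  by apply/truncn_def => //; rewrite h1.
have grid_ge0 n k : 0 <= grid n k by rewrite divr_ge0// mulr_ge0// ltW.
have kappa_lt n w : D w -> (kappa n w < n.+1)%N.
  move=> Dw; have [_ v0 vt] := tau_fin w Dw.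
  have [H _] := kappaE n w (kappa n w) Dw; have /andP[h _] := H erefl.
  rewrite -(ltr_nat R); have := le_lt_trans h vt.
  by rewrite /grid ltr_pdivrMr// ltr_pM2l.
have grid_le n k : (k < n.+1)%N -> grid n k.+1 <= t.
  by move=> kn; rewrite /grid ler_pdivrMr// ler_pM2l// ler_nat.
(* Whether [tau] lies in a cell is known at its right endpoint: the event is the difference of two
   events [tau < v], at the right and at the left endpoint. *)
have DkF n k : (k < n.+1)%N -> F (grid n k.+1) (D `&` [set w | kappa n w = k]).
  move=> kn.
  have g1 : 0 < grid n k.+1 by rewrite /grid divr_gt0// mulr_gt0.
  have -> : D `&` [set w | kappa n w = k] =
     (A `&` [set w | (tau w < (grid n k.+1)%:E)%E]) `\`
     (A `&` [set w | (tau w < (grid n k)%:E)%E]).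
    apply/seteqP; split=> w /=.
      move=> [Dw kw]; have [te v0 vt] := tau_fin w Dw.
      move/(kappaE n w k Dw) : kw => /andP[h1 h2].
      case: Dw => Aw _; rewrite te !lte_fin; split=> //.
      by move=> [_]; rewrite ltNge h1.
    move=> [[Aw h1] h2].
    have Dw : D w by split=> //=; apply: lt_le_trans h1 _; rewrite lee_fin grid_le.
    have [te v0 vt] := tau_fin w Dw.
    split=> //; apply/(kappaE n w k Dw); move: h1 h2; rewrite te !lte_fin => -> h2.
    by rewrite andbT leNgt; apply/negP => h; apply: h2.
  apply: natural_filtrationD; first exact: AF (grid_le _ _ kn).
  (* The assumption on [A] concerns positive times; at the left endpoint 0 of the initial cell the
     event is empty. *)
  have [k0|k0] := posnP k.
    rewrite (_ : _ `&` _ = set0); first exact: sigma_algebra0.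
    apply/seteqP; split => // w [_ /=]; rewrite k0 /grid mulr0 mul0r.
    by rewrite ltNge (st.1 w).
  have gk : grid n k <= grid n k.+1.
    by rewrite /grid ler_pM2r ?invr_gt0// ler_pM2l// ler_nat.
  apply: (@natural_filtration_le _ _ _ _ _ (grid n k)) => //.
  apply: AF; first by rewrite /grid divr_gt0// mulr_gt0// ltr0n.
  exact: le_trans gk (grid_le _ _ kn).
have Dkm n k : measurable (D `&` [set w | kappa n w = k]).
  have [kn|kn] := ltnP k n.+1; first exact: natural_filtration_measurable (DkF _ _ kn).
  rewrite (_ : _ `&` _ = set0)//; apply/seteqP; split => // w [Dw /= kw].
  by have := kappa_lt n w Dw; rewrite kw ltnNge kn.
have mMB v : measurable_fun setT (fun w => M v (B v w)) by exact: measurableT_comp.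
pose X n w := M (grid n (kappa n w).+1) (B (grid n (kappa n w).+1) w).
have XE n := integral_partition_nat P (Dkm n) (kappa_lt n)
  (fun k => mMB (grid n k.+1)).
have intB2 := integrable_BM_sqr hB (ltW t0).
have intB := integrable_BM hB (ltW t0).
have Mt2 : P.-integrable setT (fun w => (M t (B t w))%:E).
  apply: (@le_integrable _ _ _ _ _ measurableT _ (fun w => C%:E * (1%:E + (`|B t w|)%:E))%E).
  - exact/measurable_EFinP.
  - move=> w _; rewrite /= lee_fin; apply: le_trans (gM t (B t w) (ltW t0) (lexx t)) _.
    exact: ler_norm.
  - apply: integrableZl => //; apply: integrableD => //.
      exact: finite_measure_integrable_cst.
    exact: (integrable_abse intB).
have MtD := integrableS measurableT mD (subsetT _) Mt2.
have fc := integrable_fin_num mD MtD.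
(* [(C (1 + |y|)) ^ 2 <= 2 C ^ 2 (1 + y ^ 2)]; by the submartingale property the bound at time [t]
   dominates, in the mean over each cell, the one at the grid time. *)
pose G w := 2 * C ^+ 2 * (1 + B t w ^+ 2).
have G0 w : 0 <= G w by apply: mulr_ge0; [rewrite mulr_ge0 ?sqr_ge0|rewrite addr_ge0 ?sqr_ge0].
have intG : P.-integrable setT (fun w => (G w)%:E).
  rewrite (_ : (fun _ => _) = (fun w => (2 * C ^+ 2)%:E * (1%:E + (B t w ^+ 2)%:E))%E).
    apply: integrableZl => //; apply: integrableD => //.
    exact: finite_measure_integrable_cst.
  by apply/funext => w; rewrite -EFinD -EFinM.
have mG : measurable_fun setT G by apply/measurable_EFinP; exact: measurable_int intG.
have GD := integrableS measurableT mD (subsetT _) intG.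
have fG := integrable_fin_num mD GD.
have H := @integral_cvg_sqr_bounded R d Omega P D mD X
  (fun w => M (fine (tau w)) (stopped_value B tau w))
  (fine (\int[P]_(w in D) (M t (B t w))%:E)%E) (fine (\int[P]_(w in D) (G w)%:E)%E)
  (fun n => (XE n).1).
have {H} [|||I1 I2] := H; last by split=> //; rewrite I2 fineK.
all: swap 1 3.
- move=> n; rewrite fineK//.
  have [_ ->] := integral_partition_nat P (Dkm n) (kappa_lt n)
    (fun k => measurable_funX 2 (mMB (grid n k.+1))).
  have [_ ->] := integral_partition_nat P (Dkm n) (kappa_lt n) (fun k => mG).
  rewrite !big_mkord; apply: lee_sum => k _.
  have gt := grid_le n k (ltn_ord k).
  have g0 := grid_ge0 n k.+1.
  have mDk := Dkm n k.
  have mE v : measurable_fun (D `&` [set w | kappa n w = k]) (fun w => (1 + B v w ^+ 2)%:E).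
    by apply/measurable_EFinP/measurable_funTS/measurable_funD => //; exact: measurable_funX.
  apply: (@le_trans _ _ (\int[P]_(w in D `&` [set w | kappa n w = k])
      ((2 * C ^+ 2)%:E * (1 + B (grid n k.+1) w ^+ 2)%:E))%E).
    apply: ge0_le_integral => //.
    + by move=> w _; rewrite lee_fin sqr_ge0.
    + by apply/measurable_EFinP/measurable_funTS/measurable_funX.
    + exact: emeasurable_funM.
    + move=> w _; rewrite -EFinM lee_fin; set y := B _ w.
      have := gM _ y g0 gt; set m := M _ y => h.
      rewrite -(real_normK (num_real m)).
      apply: (@le_trans _ _ ((C * (1 + `|y|)) ^+ 2)).
        by rewrite lerXn2r ?nnegrE// (le_trans _ h).
      rewrite exprMn -(mulrA 2) (mulrCA 2); apply: ler_wpM2l; first exact: sqr_ge0.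
      by have := sqr_ge0 (`|y| - 1); rewrite -(real_normK (num_real y)); nra.
  under [leRHS]eq_integral do rewrite /G EFinM.
  have C0 : 0 <= 2 * C ^+ 2 by rewrite mulr_ge0 ?sqr_ge0.
  have one0 v w : (0 <= (1 + B v w ^+ 2)%:E)%E by rewrite lee_fin addr_ge0 ?sqr_ge0.
  rewrite !ge0_integralZl ?lee_fin//.
  apply: lee_wpmul2l; first by rewrite lee_fin.
  under eq_integral do rewrite EFinD.
  under [leRHS]eq_integral do rewrite EFinD.
  have mB2 v : measurable_fun (D `&` [set w | kappa n w = k]) (fun w => (B v w ^+ 2)%:E).
    by apply/measurable_EFinP/measurable_funTS/measurable_funX.
  rewrite !ge0_integralD//; try by move=> w _; rewrite lee_fin sqr_ge0.
  by apply: leeD2l; apply: (submartingale_BM_sqr hB) => //; exact: DkF.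
- move=> n; rewrite fineK// (XE n).2.
  have [_ ->] := integral_partition_nat P (Dkm n) (kappa_lt n) (fun k => mMB t).
  rewrite !big_mkord; apply: eq_bigr => k _; apply/esym; apply: martM => //.
    exact: grid_le.
  exact: DkF.
- move=> w Dw; have [te v0 vt] := tau_fin w Dw.
  set v := fine (tau w) in v0 vt *.
  have cgrid : grid n (kappa n w).+1 @[n --> \oo] --> v.
    have H n : v <= grid n (kappa n w).+1 <= v + t * n.+1%:R^-1.
      have [H _] := kappaE n w (kappa n w) Dw; have /andP[h1 h2] := H erefl.
      rewrite (ltW h2)/= /grid -natr1 mulrDr mulr1 mulrDl lerD2r.
      exact: h1.
    apply: (@squeeze_cvgr _ _ _ _ (fun=> v) (fun n => v + t * n.+1%:R^-1)).
    + exact: nearW.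
    + exact: cvg_cst.
    + rewrite -[X in _ --> X]addr0; apply: cvgD; first exact: cvg_cst.
      by rewrite -[X in _ --> X](mulr0 t); apply: cvgM; [exact: cvg_cst|exact: cvg_harmonic].
  by apply: cM => //; apply: (cvg_path hB).
Qed.

End OptionalStopping.

(** * Root barriers *)

Section BarrierFacts.
Context (R : realType) (Rb : set (\bar R * \bar R)) (hRb : root_barrier Rb).
Local Notation r := (barrier_function Rb).

Lemma barrier_seq_closed (t_ y_ : nat -> R) (t y : R) :
  (forall n, Rb ((t_ n)%:E, (y_ n)%:E)) ->
  t_ n @[n --> \oo] --> t -> y_ n @[n --> \oo] --> y -> Rb (t%:E, y%:E).
Proof.
move=> H ct cy.
have ct' : (t_ n)%:E @[n --> \oo] --> t%:E by apply: cvg_EFin => //; exact: nearW.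
have cy' : (y_ n)%:E @[n --> \oo] --> y%:E by apply: cvg_EFin => //; exact: nearW.
exact: (@closed_cvg _ _ \oo _ (fun n => ((t_ n)%:E, (y_ n)%:E)) Rb (rb_closed hRb)
  (nearW _ H) (t%:E, y%:E) (cvg_pair ct' cy')).
Qed.

Lemma barrier_function_ge0 x : (0 <= r x)%E.
Proof. by apply: le_ereal_inf_tmp => t []. Qed.

Lemma barrier_attained (x rho : R) : r x%:E = rho%:E -> Rb (rho%:E, x%:E).
Proof.
move=> rE.
have H n : exists t : R, rho <= t < rho + n.+1%:R^-1 /\ Rb (t%:E, x%:E).
  have : (ereal_inf [set t | 0 <= t /\ Rb (t, x%:E)] < (rho + n.+1%:R^-1)%:E)%E.
    by rewrite -/(r x%:E) rE lte_fin ltrDl invr_gt0.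
  move=> /ereal_inf_lt[t [t0 Rt] tlt].
  have ft : t \is a fin_num by rewrite ge0_fin_numE// (lt_trans tlt)// ltry.
  exists (fine t); rewrite -lte_fin -lee_fin fineK// tlt andbT -rE; split => //.
  exact: ereal_inf_lbound.
have [t_ Ht] := choice H.
apply: (@barrier_seq_closed t_ (fun=> x)); first by move=> n; case: (Ht n).
- apply: (@squeeze_cvgr _ _ _ _ (fun=> rho) (fun n => rho + n.+1%:R^-1)).
  + by apply: nearW => n; case: (Ht n) => /andP[-> /ltW ->].
  + exact: cvg_cst.
  + by rewrite -[X in _ --> X]addr0; apply: cvgD; [exact: cvg_cst|exact: cvg_harmonic].
- exact: cvg_cst.
Qed.

Lemma barrierE (t x : R) : 0 <= t -> Rb (t%:E, x%:E) <-> (r x%:E <= t%:E)%E.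
Proof.
move=> t0; split=> [Rt|rt]; first by apply: ereal_inf_lbound.
have fr : r x%:E \is a fin_num.
  by rewrite ge0_fin_numE ?barrier_function_ge0// (le_lt_trans rt)// ltry.
have /barrier_attained : r x%:E = (fine (r x%:E))%:E by rewrite fineK.
move=> /(rb_shift hRb) H.
have := H (t - fine (r x%:E))%:E; rewrite -EFinD subrKC; apply.
by rewrite lee_fin subr_ge0 -lee_fin fineK.
Qed.

(** Closedness of the barrier makes [r] lower semicontinuous: for [c >= 0] the sublevel set of [r]
    is the section of the barrier at time [c]. *)
Lemma measurable_barrier_function : measurable_fun [set: R] (fun y : R => r y%:E).
Proof.
apply: (measurability _ (ErealGenOInfty.measurableE R)) => //.
move=> /= _ [_ [c ->] <-]; rewrite setTI.
have [c0|c0] := ltP c 0.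
  rewrite (_ : _ @^-1` _ = setT)//; apply/seteqP; split => // y _ /=.
  by rewrite in_itv/= andbT (lt_le_trans _ (barrier_function_ge0 _))// lte_fin.
rewrite (_ : _ @^-1` _ = ~` [set y : R | Rb (c%:E, y%:E)]); last first.
  apply/seteqP; split=> y /=; rewrite in_itv/= andbT => h.
    by move/(barrierE _ c0); rewrite leNgt h.
  by rewrite ltNge; apply/negP => /(barrierE _ c0).
apply: measurableC; apply: closed_measurable.
apply: (@preimage_closed _ _ (fun y : R => (c%:E, y%:E)) Rb); last exact: rb_closed hRb.
move=> y _.
have c1 : c%:E @[_ --> y] --> c%:E by exact: cvg_cst.
have c2 : z%:E @[z --> y] --> y%:E by apply: cvg_EFin; [exact: nearW|exact: cvg_id].
exact: (cvg_pair c1 c2).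
Qed.

(** Such a [y] is the first point to the right of [p] at which [r] is at most [q], hence unique for
    given [q] and [p]; [right_jump] is the mirror image. *)
Definition left_jump (q p y : R) :=
  [/\ (r y%:E <= q%:E)%E, p < y & forall z, p < z -> z < y -> (q%:E < r z%:E)%E].

Definition right_jump (q p y : R) :=
  [/\ (r y%:E <= q%:E)%E, y < p & forall z, z < p -> y < z -> (q%:E < r z%:E)%E].

Lemma left_jump_unique q p y y' : left_jump q p y -> left_jump q p y' -> y = y'.
Proof.
move=> [r1 p1 H1] [r2 p2 H2]; case: (ltgtP y y') => // yy.
  by move: (H2 _ p1 yy); rewrite ltNge r1.
by move: (H1 _ p2 yy); rewrite ltNge r2.
Qed.

Lemma right_jump_unique q p y y' : right_jump q p y -> right_jump q p y' -> y = y'.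
Proof.
move=> [r1 p1 H1] [r2 p2 H2]; case: (ltgtP y y') => // yy.
  by move: (H1 _ p2 yy); rewrite ltNge r2.
by move: (H2 _ p1 yy); rewrite ltNge r1.
Qed.

(** Rational levels and endpoints make this a countable union of sets with at most one point
    each. *)
Definition jump_set : set R :=
  \bigcup_(a : rat * rat) ([set y | left_jump (ratr a.1) (ratr a.2) y] `|`
                           [set y | right_jump (ratr a.1) (ratr a.2) y]).

Lemma jump_set_negligible (mu : probability (measurableTypeR R) R) :
  atom_free mu -> mu.-negligible jump_set.
Proof.
move=> af.
have sub (J : set R) : (forall y y', J y -> J y' -> y = y') -> mu.-negligible J.
  move=> Ju; have [->|/set0P[y Jy]] := eqVneq J set0; first exact: negligible_set0.
  by exists [set y]; split; [exact: measurable_set1|exact: af|move=> z Jz; exact: Ju].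
rewrite (_ : jump_set = \bigcup_n (if unpickle n is Some a then
   [set y | left_jump (ratr a.1) (ratr a.2) y] `|` [set y | right_jump (ratr a.1) (ratr a.2) y]
   else set0)).
  apply: negligible_bigcup => n; case: unpickle => [a|]; last exact: negligible_set0.
  apply: negligibleU; apply: sub => y y'; [exact: left_jump_unique|exact: right_jump_unique].
apply/seteqP; split=> y.
  move=> [a _ Ja]; exists (pickle a); first exact: I.
  rewrite pickleK; exact: Ja.
by move=> [n _]; case: unpickle => [a Ja|[]]; exists a.
Qed.

(** * Behaviour of a path at the first hitting time of the barrier *)

Section RootTime.
Context (d : measure_display) (Omega : measurableType d).
Context (P : probability Omega R) (B : R -> {RV P >-> R}) (hB : brownian_motion B).
Local Notation tau := (root_time B Rb).

Lemma root_time_ge0 w : (0 <= tau w)%E.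
Proof. by apply: le_ereal_inf_tmp => _ [t [t0 _] <-]; rewrite lee_fin ltW. Qed.

Lemma root_time_le w (t : R) : 0 < t -> (r (B t w)%:E <= t%:E)%E -> (tau w <= t%:E)%E.
Proof.
move=> t0 rt; apply: ereal_inf_lbound; exists t => //; split => //.
by apply/barrierE => //; exact: ltW.
Qed.

Lemma barrier_at_root_time w (v : R) : tau w = v%:E -> (r (B v w)%:E <= v%:E)%E.
Proof.
move=> tv; have v0 : 0 <= v by rewrite -lee_fin -tv root_time_ge0.
have H n : exists t : R, [/\ 0 < t, v <= t < v + n.+1%:R^-1 & Rb (t%:E, (B t w)%:E)].
  have : (tau w < (v + n.+1%:R^-1)%:E)%E by rewrite tv lte_fin ltrDl invr_gt0.
  move=> /ereal_inf_lt[_ [t [t0 Rt] <-]]; rewrite lte_fin => tlt.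
  exists t; split => //; rewrite tlt andbT -lee_fin -tv.
  by apply: ereal_inf_lbound; exists t.
have [t_ Ht] := choice H.
have ct : t_ n @[n --> \oo] --> v.
  apply: (@squeeze_cvgr _ _ _ _ (fun=> v) (fun n => v + n.+1%:R^-1)).
  + by apply: nearW => n; case: (Ht n) => _ /andP[-> /ltW ->].
  + exact: cvg_cst.
  + by rewrite -[X in _ --> X]addr0; apply: cvgD; [exact: cvg_cst|exact: cvg_harmonic].
apply/barrierE => //; apply: (@barrier_seq_closed t_ (fun n => B (t_ n) w)) => //.
- by move=> n; case: (Ht n).
- apply: (cvg_path hB) => // n; by case: (Ht n) => /ltW.
Qed.

(** Take [q] rational with [r y < q < v]. At time [q] the path is not at [y], since it would then
    already be in the barrier. All levels it sweeps on its way to [y] have [r] above [q], while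
    [r y <= q]: a jump on the side of approach. *)
Lemma root_time_jump w (v : R) : tau w = v%:E -> (r (B v w)%:E < v%:E)%E ->
  jump_set (B v w).
Proof.
move=> tv rv; set y := B v w in rv *.
have before t : 0 < t -> t < v -> (t%:E < r (B t w)%:E)%E.
  move=> t0 t_v; rewrite ltNge; apply/negP => /(root_time_le t0).
  by rewrite tv lee_fin leNgt t_v.
have fr : r y%:E \is a fin_num.
  by rewrite ge0_fin_numE ?barrier_function_ge0// (lt_trans rv)// ltry.
have rho0 : 0 <= fine (r y%:E) by rewrite fine_ge0 ?barrier_function_ge0.
have : fine (r y%:E) < v by rewrite -lte_fin fineK.
move=> /rat_in_itvoo[q]; rewrite in_itv/= => /andP[rq qv].
have q0 : 0 < ratr q :> R by apply: le_lt_trans rho0 rq.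
have ryq : (r y%:E <= (ratr q)%:E)%E by rewrite -(fineK fr) lee_fin ltW.
have bq : B (ratr q) w != y.
  apply/eqP => E; have := before _ q0 qv; by rewrite E ltNge ryq.
(* On the time interval [[q, v[] the path crosses [z] above time [q] without entering
   the barrier. *)
have cross z : Num.min (B (ratr q) w) y <= z <= Num.max (B (ratr q) w) y -> z != y ->
    ((ratr q)%:E < r z%:E)%E.
  move=> zz zy; have [t] := path_IVT hB (ltW q0) (ltW qv) zz.
  rewrite in_itv/= => /andP[qt tv'] Bt.
  have t_v : t < v by rewrite lt_neqAle tv' andbT; apply/eqP => E; move: zy; rewrite -Bt /y -E eqxx.
  have := before t (lt_le_trans q0 qt) t_v; rewrite Bt.
  by apply: le_lt_trans; rewrite lee_fin.
case: (ltgtP (B (ratr q) w) y) bq => // [lty|gty] _.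
- have [p] := rat_in_itvoo lty; rewrite in_itv/= => /andP[bp py].
  exists (q, p) => //; left; split => //= z pz zy.
  apply: cross; last by rewrite lt_eqF.
  by rewrite (min_l (ltW lty)) (max_r (ltW lty)) (ltW zy) andbT ltW// (lt_trans bp).
- have [p] := rat_in_itvoo gty; rewrite in_itv/= => /andP[yp pb].
  exists (q, p) => //; right; split => //= z zp yz.
  apply: cross; last by rewrite gt_eqF.
  by rewrite (min_r (ltW gty)) (max_l (ltW gty)) (ltW yz)/= ltW// (lt_trans zp).
Qed.

Lemma root_time_barrier w (v : R) : tau w = v%:E -> ~ jump_set (B v w) ->
  r (B v w)%:E = tau w.
Proof.
move=> tv nj; apply/eqP; rewrite eq_le tv (barrier_at_root_time tv)/= leNgt.
by apply/negP => /(root_time_jump tv).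
Qed.

(** From time [s] on the level [x] belongs to the barrier, so the path does not meet [x] during [[s,
    v[], and the intermediate value theorem keeps it on one side. The conclusions are weak because
    it may be stopped at [x] itself. *)
Lemma root_time_side w (v s x : R) : tau w = v%:E -> 0 < s -> s <= v ->
  (r x%:E <= s%:E)%E ->
  (x < B s w -> x <= B v w) /\ (B s w <= x -> B v w <= x).
Proof.
move=> tv s0 sv rx.
have nohit t : s <= t -> t < v -> B t w != x.
  move=> st t_v; apply/eqP => Bt.
  have : (tau w <= t%:E)%E.
    by apply: root_time_le; [exact: lt_le_trans st|rewrite Bt (le_trans rx)// lee_fin].
  by rewrite tv lee_fin leNgt t_v.
split=> Bs; rewrite leNgt; apply/negP => Bv.
- have zz : Num.min (B s w) (B v w) <= x <= Num.max (B s w) (B v w).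
    by rewrite (min_r (ltW (lt_trans Bv Bs))) (max_l (ltW (lt_trans Bv Bs))) !ltW.
  have [t] := path_IVT hB (ltW s0) sv zz.
  rewrite in_itv/= => /andP[st tv'] Bt.
  have t_v : t < v.
    by rewrite lt_neqAle tv' andbT; apply/eqP => E; move: Bv; rewrite -E Bt ltxx.
  by have := nohit t st t_v; rewrite Bt eqxx.
- have zz : Num.min (B s w) (B v w) <= x <= Num.max (B s w) (B v w).
    by rewrite (min_l (ltW (le_lt_trans Bs Bv))) (max_r (ltW (le_lt_trans Bs Bv))) Bs ltW.
  have [t] := path_IVT hB (ltW s0) sv zz.
  rewrite in_itv/= => /andP[st tv'] Bt.
  have t_v : t < v.
    by rewrite lt_neqAle tv' andbT; apply/eqP => E; move: Bv; rewrite -E Bt ltxx.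
  by have := nohit t st t_v; rewrite Bt eqxx.
Qed.

End RootTime.
End BarrierFacts.

(** * The Volterra equation *)

Section Volterra.
Context (R : realType) (d : measure_display) (Omega : measurableType d).
Context (P : probability Omega R) (B : R -> {RV P >-> R}) (hB : brownian_motion B).
Context (mu : probability (measurableTypeR R) R).
Context (mu_atom_free : atom_free mu) (mu_zero_mean : zero_mean mu).
Context (Rb : set (\bar R * \bar R)) (hRb : root_barrier Rb).
Local Notation r := (barrier_function Rb).
Local Notation tau := (root_time B Rb).
Context (sk : solves_skorokhod B mu tau).
Local Notation F := (natural_filtration B).
Local Notation T := (stopped_value B tau).
Local Notation X := (stopped_process B tau).
Local Notation before s := [set w | (tau w < s%:E)%E].
Local Notation after s := [set w | (s%:E <= tau w)%E].

Let st : stopping_time B tau := sk_stopping sk.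

(** * The stopped value and the stopped process at a fixed time *)

Lemma measurable_before s : measurable (before s).
Proof.
have := emeasurable_fun_infty_o measurableT (measurable_stopping_time st) s%:E.
by rewrite setTI.
Qed.

Lemma measurable_after s : measurable (after s).
Proof.
have := emeasurable_fun_c_infty measurableT (measurable_stopping_time st) s%:E.
by rewrite setTI.
Qed.

Lemma before_after s : before s `|` after s = setT.
Proof. by apply/seteqP; split=> // w _ /=; case: (ltP (tau w) s%:E); [left|right]. Qed.

Lemma disjoint_before_after s : [disjoint before s & after s].
Proof.
apply/disj_setPS => w [/= h1 h2].
by move: h1; rewrite ltNge h2.
Qed.

Lemma stopped_process_before s w : before s w -> X s w = T w.
Proof.
move=> ws; rewrite /stopped_process /stopped_value.
by rewrite min_r// ltW.
Qed.

Lemma stopped_process_after s w : after s w -> X s w = B s w.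
Proof.
move=> ws; rewrite /stopped_process /stopped_value.
by rewrite min_l.
Qed.

(** Only the traces of [A] on [tau < v] have to be known at time [v]. This covers the whole space,
    and also events known at a time [s] on which [tau >= s], whose traces are empty for [v <= s]. *)
Lemma optional_stopping_BM t A : 0 < t ->
  (forall v, 0 < v -> v <= t -> F v (A `&` before v)) ->
  P.-integrable (A `&` before t) (fun w => (T w)%:E) /\
  (\int[P]_(w in A `&` before t) (T w)%:E = \int[P]_(w in A `&` before t) (B t w)%:E)%E.
Proof.
move=> t0 AF.
apply: (@optional_stopping _ _ _ _ _ hB tau t A (fun _ y => y) 1 st t0 AF).
- by move=> v; exact: measurable_id.
- by move=> v_ y_ v y _.
- by move=> v y _ _; rewrite mul1r lerDr.
- by move=> v E v0 vt FE; exact: martingale_BM.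
Qed.

Lemma before_filtration v : 0 < v -> F v (setT `&` before v).
Proof. by move=> v0; rewrite setTI; exact: stopping_time_lt. Qed.

(** Measurability is part of the integrability found by optional stopping, where [T] is a limit of
    its discretisations. *)
Lemma measurable_stopped_before s : 0 < s -> measurable_fun (before s) T.
Proof.
move=> s0; have [+ _] := optional_stopping_BM s0 (fun v v0 _ => before_filtration v0).
by rewrite setTI => /measurable_int/measurable_EFinP.
Qed.

Lemma measurable_stopped_value : measurable_fun setT T.
Proof.
have -> : setT = (\bigcup_n before n.+1%:R) `|` [set w | tau w = +oo%E].
  apply/seteqP; split=> // w _; have tau0 := root_time_ge0 Rb B w.
  have [ty|ty] := eqVneq (tau w) +oo%E; first by right.
  have fw : tau w \is a fin_num by rewrite ge0_fin_numE// ltey.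
  left; exists (Num.truncn (fine (tau w))); first exact: I.
  by rewrite /= -(fineK fw) lte_fin truncnS_gt.
have mb : forall n : nat, measurable (before n.+1%:R) by move=> n; exact: measurable_before.
have my : measurable [set w | tau w = +oo%E].
  rewrite (_ : [set w | _] = tau @^-1` [set +oo%E])//.
  rewrite -[_ @^-1` _]setTI.
  exact: (measurable_stopping_time st measurableT (emeasurable_set1 +oo%E)).
apply/measurable_funU => //; first exact: bigcup_measurable.
split; first by apply/measurable_fun_bigcup => // n; exact: measurable_stopped_before.
(* Since [fine +oo = 0], on this set [T] is the starting value [B 0 w = 0]. *)
apply: (eq_measurable_fun (fun=> 0 : R)); last exact: measurable_cst.
by move=> w; rewrite inE /= => tw; rewrite /stopped_value tw/= (bm_start hB).
Qed.

Lemma ge0_integral_law (f : R -> \bar R) : measurable_fun [set: R] f ->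
  (forall y, (0 <= f y)%E) -> (\int[P]_w f (T w) = \int[mu]_y f y)%E.
Proof.
move=> mf f0.
pose Y (w : Omega) : measurableTypeR R := T w.
have mY : measurable_fun [set: Omega] Y by exact: measurable_stopped_value.
transitivity (\int[pushforward P Y]_y f y)%E.
  by rewrite ge0_integral_pushforward.
apply: eq_measure_integral => A mA _ /=.
by rewrite -(sk_law sk mA).
Qed.

Lemma integrable_stopped_value : P.-integrable setT (fun w => (T w)%:E).
Proof.
apply/integrableP; split; first exact/measurable_EFinP/measurable_stopped_value.
rewrite (@ge0_integral_law (fun y => `|y%:E|%E))//.
  by have /integrableP[] := mu_zero_mean.1.
exact: measurableT_comp.
Qed.

Lemma integral_stopped_value : (\int[P]_w (T w)%:E = 0)%E.
Proof.
rewrite -mu_zero_mean.2 integralE [RHS]integralE.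
have mid : measurable_fun [set: R] (fun z : R => z%:E) by exact: EFin_measurable.
have := ge0_integral_law (measurable_funepos mid) (fun z => funepos_ge0 _ z).
have := ge0_integral_law (measurable_funeneg mid) (fun z => funeneg_ge0 _ z).
move=> <- <-; congr (_ - _)%E; apply: eq_integral => w _.
  by rewrite !funeposE.
by rewrite !funenegE.
Qed.

Lemma integrable_dist (Y : Omega -> R) x : P.-integrable setT (fun w => (Y w)%:E) ->
  P.-integrable setT (fun w => (`|Y w - x|)%:E).
Proof.
move=> IY; have I : P.-integrable setT (fun w => (Y w)%:E - x%:E)%E.
  by apply: integrableB => //; exact: finite_measure_integrable_cst.
exact: (integrable_abse I).
Qed.

Lemma integral_split s (f : Omega -> \bar R) : measurable_fun setT f ->
  (\int[P]_w f w = \int[P]_(w in before s) f w + \int[P]_(w in after s) f w)%E.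
Proof.
move=> mf; rewrite -(before_after s) integral_setU//.
- exact: measurable_before.
- exact: measurable_after.
- by rewrite before_after.
- exact: disjoint_before_after.
Qed.

Lemma measurable_stopped_process s : measurable_fun setT (X s).
Proof.
rewrite -(before_after s); apply/measurable_funU.
- exact: measurable_before.
- exact: measurable_after.
split.
- apply: (eq_measurable_fun T); last by apply: measurable_funTS; exact: measurable_stopped_value.
  by move=> w; rewrite inE => /stopped_process_before ->.
- apply: (eq_measurable_fun (B s)); last exact: measurable_funTS.
  by move=> w; rewrite inE => /stopped_process_after ->.
Qed.

Lemma integral_stopped_process s (f : R -> \bar R) : measurable_fun [set: R] f ->
  (\int[P]_w f (X s w) = \int[P]_(w in before s) f (T w) + \int[P]_(w in after s) f (B s w))%E.
Proof.
move=> mf; rewrite (integral_split s); last first.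
  by apply: measurableT_comp => //; exact: measurable_stopped_process.
congr (_ + _)%E; apply: eq_integral => w; rewrite inE.
  by move=> /stopped_process_before ->.
by move=> /stopped_process_after ->.
Qed.

(** * The mean distance of the stopped process from a point *)

Lemma optional_stopping_dist s x : 0 < s ->
  (\int[P]_(w in before s) (`|T w - x| + g (s - fine (tau w)) (x - T w))%:E =
   \int[P]_(w in before s) (`|B s w - x|)%:E)%E.
Proof.
move=> s0.
(* The growth constant comes from [g (s - v) (x - y) <= sqrt (2 s / pi)]. At the terminal time
   [v = s] the term with [g] vanishes. *)
have := @optional_stopping _ _ _ _ _ hB tau s setT
  (fun v y => `|y - x| + g (s - v) (x - y)) (1 + `|x| + Num.sqrt (2 * s / pi)) st s0
  (fun v v0 _ => before_filtration v0).
rewrite setTI => H.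
have [] := H.
- move=> v; apply: measurable_funD.
    by apply: measurableT_comp => //; exact: measurable_funB.
  by apply: measurable_g => //; exact: measurable_funB.
- move=> v_ y_ v y cv cy; apply: cvgD.
    by apply: cvg_norm; apply: cvgB => //; exact: cvg_cst.
  by apply: (g_cvg hB); apply: cvgB => //; exact: cvg_cst.
- move=> v y v0 vs; rewrite ger0_norm; last by rewrite addr_ge0// (g_ge0 hB).
  have sv : 0 <= s - v by rewrite subr_ge0.
  have h1 := g_le (x - y) sv.
  have h2 : Num.sqrt (2 * (s - v) / pi) <= Num.sqrt (2 * s / pi).
    rewrite ler_sqrt; last by rewrite mulr_ge0 ?invr_ge0 ?pi_ge0// mulr_ge0 ?ltW.
    by rewrite ler_pM2r ?invr_gt0 ?pi_gt0// ler_pM2l// lerBlDr lerDl.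
  have h3 := ler_normB y x.
  have h4 : 0 <= (`|x| + Num.sqrt (2 * s / pi)) * `|y|.
    by rewrite mulr_ge0// addr_ge0// sqrtr_ge0.
  apply: (@le_trans _ _ (`|y| + `|x| + Num.sqrt (2 * s / pi))).
    by rewrite lerD// (le_trans h1).
  by move: h4; rewrite !mulrDl !mulrDr !mul1r !mulr1; lra.
- move=> v E v0 vs FE; rewrite subrr.
  under eq_integral do rewrite /g lexx addr0.
  exact: martingale_BM_dist.
- move=> _ ->; apply: eq_integral => w _.
  by rewrite subrr /g lexx addr0.
Qed.

Lemma ae_root_time_barrier :
  {ae P, forall w, tau w \is a fin_num /\ r (T w)%:E = tau w}.
Proof.
have [N [mN muN jN]] := jump_set_negligible Rb mu_atom_free.
have n1 : P.-negligible (T @^-1` N).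
  exists (T @^-1` N); split => //.
    by rewrite -[X in measurable X]setTI; exact: (measurable_stopped_value measurableT mN).
  by rewrite -muN; exact: (sk_law sk mN).
have n2 : P.-negligible [set w | tau w = +oo%E].
  exists [set w | tau w = +oo%E]; split => //; last exact: sk_finite sk.
  rewrite (_ : [set w | _] = tau @^-1` [set +oo%E])//.
  rewrite -[_ @^-1` _]setTI.
  exact: (measurable_stopping_time st measurableT (emeasurable_set1 +oo%E)).
apply: negligibleS (negligibleU n1 n2) => w /= H.
have [ty|ty] := eqVneq (tau w) +oo%E; first by right.
left; apply: contrapT => nN; apply: H.
have fw : tau w \is a fin_num by rewrite ge0_fin_numE ?root_time_ge0// ltey.
split => //; apply: (root_time_barrier hRb hB (v := fine (tau w))).
  by rewrite fineK.
by move=> /jN.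
Qed.

Lemma integral_g_law s x :
  (\int[P]_(w in before s) (g (s - fine (tau w)) (x - T w))%:E =
   \int[mu]_(y in [set y : R | (r y%:E < s%:E)%E]) (g (s - fine (r y%:E)) (x - y))%:E)%E.
Proof.
have mr := measurable_barrier_function hRb.
have mD : measurable [set y : R | (r y%:E < s%:E)%E].
  by have := emeasurable_fun_infty_o measurableT mr s%:E; rewrite setTI.
have mf : measurable_fun [set: R] (fun y => (g (s - fine (r y%:E)) (x - y))%:E).
  apply/measurable_EFinP/measurable_g => //; last exact: measurable_funB.
  by apply: measurable_funB => //; exact: (measurableT_comp (fine_measurable measurableT) mr).
(* The restriction to [r y < s] is part of the function, because the event [tau < s] too must be
   expressed through [T]. *)
pose f := (fun y => (g (s - fine (r y%:E)) (x - y))%:E) \_ [set y : R | (r y%:E < s%:E)%E].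
have mf' : measurable_fun [set: R] f by apply/(measurable_restrictT _ mD); exact: measurable_funTS.
have f0 y : (0 <= f y)%E.
  by rewrite /f/patch; case: ifPn => // _; rewrite lee_fin (g_ge0 hB).
rewrite [RHS]integral_mkcond -/f -(ge0_integral_law mf' f0) integral_mkcond.
have mg : measurable_fun setT (fun w => (g (s - fine (tau w)) (x - T w))%:E).
  apply/measurable_EFinP/measurable_g => //.
    apply: measurable_funB => //.
    exact: (measurableT_comp (fine_measurable measurableT) (measurable_stopping_time st)).
  by apply: measurable_funB => //; exact: measurable_stopped_value.
apply: ae_eq_integral.
- exact: measurableT.
- by apply/(measurable_restrictT _ (measurable_before s)); exact: measurable_funTS.
- by apply: measurableT_comp => //; exact: measurable_stopped_value.
apply: filterS ae_root_time_barrier => w [fw rw] _.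
rewrite /f /patch rw; congr (if _ then _ else _).
by apply/idP/idP; rewrite !inE /= rw.
Qed.

(** This reads [volterra_rhs] as [E|X_s - x| - |x|] for every [s > 0], whatever its position
    relative to [r x]; what remains is to compare [X s] with [T]. *)
Lemma integral_stopped_process_dist s x : 0 < s ->
  (\int[P]_w (`|X s w - x|)%:E = (`|x| + volterra_rhs mu r s x)%:E)%E.
Proof.
move=> s0.
have md : measurable_fun [set: R] (fun y : R => (`|y - x|)%:E).
  by apply/measurable_EFinP/measurableT_comp => //; exact: measurable_funB.
rewrite (integral_stopped_process s md).
have mBd : measurable_fun setT (fun w => (`|B s w - x|)%:E) by exact: (measurableT_comp md).
have mTd : measurable_fun setT (fun w => (`|T w - x|)%:E).
  by apply: (measurableT_comp md); exact: measurable_stopped_value.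
have mg : measurable_fun setT (fun w => (g (s - fine (tau w)) (x - T w))%:E).
  apply/measurable_EFinP/measurable_g => //.
    apply: measurable_funB => //.
    exact: (measurableT_comp (fine_measurable measurableT) (measurable_stopping_time st)).
  by apply: measurable_funB => //; exact: measurable_stopped_value.
have := integral_BM_dist hB x (ltW s0).
rewrite (integral_split s mBd) -(optional_stopping_dist x s0).
under eq_integral do rewrite EFinD.
have mbs := measurable_before s.
rewrite ge0_integralD//; last 3 first.
- exact: measurable_funTS.
- by move=> w _; rewrite lee_fin (g_ge0 hB).
- exact: measurable_funTS.
rewrite integral_g_law /volterra_rhs /Rintegral.
set a := (\int[P]_(w in before s) _)%E; set b := (\int[P]_(w in after s) _)%E.
set G := (\int[mu]_(y in _) _)%E.
have a0 : (0 <= a)%E by apply: integral_ge0 => w _; rewrite lee_fin.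
have b0 : (0 <= b)%E by apply: integral_ge0 => w _; rewrite lee_fin.
have G0 : (0 <= G)%E by apply: integral_ge0 => w _; rewrite lee_fin (g_ge0 hB).
move=> H.
(* [G] is at most the finite total [|x| + g s x], which permits its subtraction in the extended
   reals. *)
have fG : G \is a fin_num.
  rewrite ge0_fin_numE//; apply: (@le_lt_trans _ _ (`|x| + g s x)%:E); last exact: ltry.
  by rewrite -H; apply: (@le_trans _ _ (a + G)%E); [exact: leeDr|exact: leeDl].
have : (a + b + G = (`|x| + g s x)%:E)%E by rewrite -H addeAC.
by move=> /(congr1 (fun e => e - G)%E); rewrite addeK// => ->; rewrite -(fineK fG) -EFinB/= addrA.
Qed.

Lemma integrable_stopped_process s : 0 < s -> P.-integrable setT (fun w => (X s w)%:E).
Proof.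
move=> s0; have mX := measurable_stopped_process s.
apply/integrableP; split; first exact/measurable_EFinP.
have := integral_stopped_process_dist 0 s0.
under eq_integral do rewrite subr0.
by move=> ->; rewrite ltry.
Qed.

(** * Passage from the stopped process to the stopped value *)

Lemma after_integral_small (c e : R) : 0 <= c -> 0 < e ->
  exists n : nat, (\int[P]_(w in after n%:R) (c + `|T w|)%:E <= e%:E)%E.
Proof.
move=> c0 e0.
have Ic : P.-integrable setT (fun w => (c + `|T w|)%:E).
  rewrite (_ : (fun _ => _) = (fun w => c%:E + (`|T w|)%:E)%E).
    apply: integrableD => //; first exact: finite_measure_integrable_cst.
    exact: (integrable_abse integrable_stopped_value).
  by apply/funext => w; rewrite EFinD.
have mc := measurable_int _ Ic.
pose f n := (fun w => (c + `|T w|)%:E) \_ (after n%:R).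
have cf0 w : (0 <= (c + `|T w|)%:E)%E by rewrite lee_fin addr_ge0.
(* [tau] is almost surely finite, so almost every point leaves [after n] for large [n]; the
   dominating function is [c + |T|]. *)
have [|||||_ _] := @dominated_convergence _ _ _ P setT measurableT f (cst 0%E)
  (fun w => (c + `|T w|)%:E).
- by move=> n; apply/(measurable_restrictT _ (measurable_after n%:R)); exact: measurable_funTS.
- exact: measurable_cst.
- apply: filterS ae_root_time_barrier => w [fw _] _.
  apply: cvg_near_cst; exists (Num.truncn (fine (tau w))).+1 => // n /= Hn.
  rewrite /f /patch; case: ifPn => //; rewrite inE /= leNgt => /negP; case.
  rewrite -(fineK fw) lte_fin.
  by apply: lt_le_trans (truncnS_gt _) _; rewrite ler_nat.
- exact: Ic.
- apply: aeW => w n _; rewrite /f /patch; case: ifPn => _.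
    by rewrite gee0_abs.
  by rewrite abse0.
rewrite integral0 => /fine_cvgP[fn /cvgrPdist_le /(_ e e0) H].
have [n _ /(_ n (leqnn _)) [/= fI]] := filterI fn H.
rewrite sub0r normrN => He; exists n.
rewrite integral_mkcond -/(f n) -(fineK fI) lee_fin.
exact: le_trans (ler_norm _) He.
Qed.

(* On [t <= tau], [|X_t| <= |X_t| 1_{|X_t| >= K} + |K|] with [K] given by uniform
   integrability. *)
Lemma stopped_process_L1 (e : R) : 0 < e ->
  exists n : nat, forall t, n%:R <= t -> 0 < t -> (\int[P]_w (`|X t w - T w|)%:E <= e%:E)%E.
Proof.
move=> e0; have e20 : 0 < e / 2 by rewrite divr_gt0.
have [K HK] := sk_ui sk e20.
have [n Hn] := after_integral_small (normr_ge0 K) e20.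
exists n => t nt t0.
have mX := measurable_stopped_process t.
have mXT : measurable_fun setT (fun w => (`|X t w - T w|)%:E).
  apply/measurable_EFinP/measurableT_comp => //.
  by apply: measurable_funB => //; exact: measurable_stopped_value.
have mXn : measurable_fun setT (fun w => (`|X t w|)%:E).
  by apply/measurable_EFinP/measurableT_comp.
have mKX : measurable [set w | K <= `|X t w|].
  have := emeasurable_fun_c_infty measurableT mXn K%:E; rewrite setTI.
  by congr measurable; apply/seteqP; split => w /=; rewrite lee_fin.
have mat := measurable_after t.
have mcT : measurable_fun setT (fun w => (`|K| + `|T w|)%:E).
  apply/measurable_EFinP/measurable_funD => //.
  by apply: measurableT_comp => //; exact: measurable_stopped_value.
rewrite (integral_split t mXT).
have -> : (\int[P]_(w in before t) (`|X t w - T w|)%:E = 0)%E.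
  under eq_integral => w.
    rewrite inE => /stopped_process_before ->; rewrite subrr normr0; over.
  by rewrite integral0.
rewrite add0e.
pose h := (fun w => (`|X t w|)%:E) \_ [set w | K <= `|X t w|].
have mh : measurable_fun setT h.
  by apply/(measurable_restrictT _ mKX); exact: measurable_funTS.
have h0 w : (0 <= h w)%E by rewrite /h /patch; case: ifPn => // _; rewrite lee_fin.
apply: (@le_trans _ _ (\int[P]_(w in after t) (h w + (`|K| + `|T w|)%:E))%E).
  apply: ge0_le_integral => //.
  - exact: measurable_funTS.
  - by apply: measurable_funTS; exact: emeasurable_funD.
  move=> w _; rewrite /h /patch; case: ifPn => [_|].
    rewrite -EFinD lee_fin; apply: le_trans (ler_normB _ _) _.
    by rewrite lerD2l lerDr.
  rewrite notin_setE /= => /negP; rewrite -ltNge => XK.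
  rewrite add0e lee_fin; apply: le_trans (ler_normB _ _) _.
  by rewrite lerD2r (le_trans (ltW XK))// ler_norm.
rewrite ge0_integralD//; last 2 first.
- exact: measurable_funTS.
- exact: measurable_funTS.
rewrite [e in (_ <= e%:E)%E]splitr EFinD; apply: leeD.
  apply: (@le_trans _ _ (\int[P]_w h w)%E).
    by apply: ge0_subset_integral.
  by rewrite /h -integral_mkcond; apply: HK; exact: ltW.
apply: le_trans Hn; apply: ge0_subset_integral => //.
- exact: measurable_after.
- exact: measurable_funTS.
- by move=> w /=; apply: le_trans; rewrite lee_fin.
Qed.

Lemma integral_dist_lip (Y Z : Omega -> R) (x e : R) :
  measurable_fun setT Y -> measurable_fun setT Z ->
  (\int[P]_w (`|Y w - Z w|)%:E <= e%:E)%E ->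
  (\int[P]_w (`|Y w - x|)%:E <= \int[P]_w (`|Z w - x|)%:E + e%:E)%E.
Proof.
move=> mY mZ YZ.
have mYx : measurable_fun setT (fun w => (`|Y w - x|)%:E).
  by apply/measurable_EFinP/measurableT_comp => //; exact: measurable_funB.
have mZx : measurable_fun setT (fun w => (`|Z w - x|)%:E).
  by apply/measurable_EFinP/measurableT_comp => //; exact: measurable_funB.
have mYZ : measurable_fun setT (fun w => (`|Y w - Z w|)%:E).
  by apply/measurable_EFinP/measurableT_comp => //; exact: measurable_funB.
apply: (@le_trans _ _ (\int[P]_w (`|Z w - x|)%:E + \int[P]_w (`|Y w - Z w|)%:E)%E).
  rewrite -ge0_integralD//; apply: ge0_le_integral => //.
    exact: emeasurable_funD.
  move=> w _; rewrite -EFinD lee_fin.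
  have -> : Y w - x = (Z w - x) + (Y w - Z w) by ring.
  exact: ler_normD.
exact: leeD2l.
Qed.

(** Optional stopping at [tau] itself. The mean of [X t] over [A] is the same for all [t >= s], and
    [X t] tends to [T] in L1. *)
Lemma stopped_value_martingale s A : 0 < s -> F s A -> A `<=` after s ->
  (\int[P]_(w in A) (T w)%:E = \int[P]_(w in A) (B s w)%:E)%E.
Proof.
move=> s0 FA sA.
have mA := natural_filtration_measurable FA.
have iTA := integrableS measurableT mA (subsetT _) integrable_stopped_value.
have iBA := integrableS measurableT mA (subsetT _) (integrable_BM hB (ltW s0)).
have Xt t : s <= t -> (\int[P]_(w in A) (X t w)%:E = \int[P]_(w in A) (B s w)%:E)%E.
  move=> st'; have t0 : 0 < t := lt_le_trans s0 st'.
  rewrite -(martingale_BM hB (ltW s0) st' FA).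
  have AE : A = (A `&` before t) `|` (A `&` after t).
    by rewrite -setIUr before_after setIT.
  have dis : [disjoint A `&` before t & A `&` after t].
    by apply/disj_setPS => w [[_ /= h1] [_ /= h2]]; move: h1; rewrite ltNge h2.
  have m1 : measurable (A `&` before t) by apply: measurableI => //; exact: measurable_before.
  have m2 : measurable (A `&` after t) by apply: measurableI => //; exact: measurable_after.
  rewrite AE !integral_setU//; last 2 first.
  - by apply/measurable_EFinP/measurable_funTS.
  - by apply/measurable_EFinP/measurable_funTS; exact: (measurable_stopped_process).
  congr (_ + _)%E.
    transitivity (\int[P]_(w in A `&` before t) (T w)%:E)%E.
      by apply: eq_integral => w; rewrite inE => -[_ /stopped_process_before ->].
    have [] // := @optional_stopping_BM t A t0.
    (* For [v <= s] the trace is empty since [tau >= s] on [A]; for [v > s] both events are known at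
       time [v]. *)
    move=> v v0 vt; have [vs|vs] := leP v s.
      rewrite (_ : _ `&` _ = set0); first exact: sigma_algebra0.
      apply/seteqP; split => // w [/sA /= h1 h2].
      by have := le_lt_trans h1 h2; rewrite lte_fin ltNge vs.
    apply: natural_filtrationI; last exact: stopping_time_lt.
    exact: natural_filtration_le (ltW vs) FA.
  by apply: eq_integral => w; rewrite inE => -[_ /stopped_process_after ->].
have fT := integrable_fin_num mA iTA.
have fB := integrable_fin_num mA iBA.
suff : `|fine (\int[P]_(w in A) (B s w)%:E) - fine (\int[P]_(w in A) (T w)%:E)| <= 0.
  by rewrite normr_le0 subr_eq0 => /eqP E; rewrite -(fineK fT) -E fineK.
apply/ler_addgt0Pl => e e0; rewrite addr0.
have [n Hn] := stopped_process_L1 e0.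
pose t := Num.max s n%:R.
have st' : s <= t by rewrite le_max lexx.
have t0 : 0 < t := lt_le_trans s0 st'.
have nt : n%:R <= t by rewrite le_max lexx orbT.
have iX := integrable_stopped_process t0.
have iXA := integrableS measurableT mA (subsetT _) iX.
have iXT : P.-integrable A (fun w => (X t w)%:E - (T w)%:E)%E by exact: integrableB.
rewrite -lee_fin; apply: le_trans (Hn t nt t0).
have mXT := measurable_int _ iXT.
apply: (@le_trans _ _ `|\int[P]_(w in A) ((X t w)%:E - (T w)%:E)|%E).
  rewrite integralB// (Xt t st') -(fineK fT) -(fineK fB) -EFinB abse_EFin lee_fin.
  by rewrite !fineK.
apply: le_trans (le_abse_integral P mA mXT) _.
apply: ge0_subset_integral => //.
apply/measurable_EFinP/measurableT_comp => //.
apply: measurable_funB; last exact: measurable_stopped_value.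
exact: (measurable_stopped_process).
Qed.

(** On one side of [x] the distance is linear, [|y - x| = c (y - x)] with [c] equal to 1 or -1, and
    linear functions are covered by the martingale identity. The sign of [T - x] is asked only where
    [tau] is finite, since the path argument needs a finite end time. *)
Lemma integral_dist_side s x c A : `|c| = 1 -> 0 < s -> F s A -> A `<=` after s ->
  (forall w, A w -> 0 <= c * (B s w - x)) ->
  (forall w, A w -> tau w \is a fin_num -> 0 <= c * (T w - x)) ->
  (\int[P]_(w in A) (`|T w - x|)%:E = \int[P]_(w in A) (`|B s w - x|)%:E)%E.
Proof.
move=> c1 s0 FA sA HB HT.
have normE y : 0 <= c * y -> `|y| = c * y by move=> h; rewrite -[RHS]ger0_norm// normrM c1 mul1r.
have mA := natural_filtration_measurable FA.
have iTA := integrableS measurableT mA (subsetT _) integrable_stopped_value.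
have iBA := integrableS measurableT mA (subsetT _) (integrable_BM hB (ltW s0)).
have iC : P.-integrable A (fun=> x%:E) by exact: finite_measure_integrable_cst.
have lin (Y : Omega -> R) : P.-integrable A (fun w => (Y w)%:E) ->
    (\int[P]_(w in A) (c * (Y w - x))%:E =
     c%:E * (\int[P]_(w in A) (Y w)%:E - \int[P]_(w in A) x%:E))%E.
  move=> iY; have iYC : P.-integrable A (fun w => (Y w)%:E - x%:E)%E by exact: integrableB.
  rewrite -(integralB mA iY iC) -(integralZl mA iYC).
  by apply: eq_integral => w _; rewrite -EFinB -EFinM.
transitivity (\int[P]_(w in A) (c * (T w - x))%:E)%E.
  apply: ae_eq_integral.
  - exact: mA.
  - apply/measurable_EFinP/measurable_funTS/measurableT_comp => //.
    by apply: measurable_funB => //; exact: measurable_stopped_value.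
  - apply/measurable_EFinP/measurable_funTS/measurable_funM => //.
    by apply: measurable_funB => //; exact: measurable_stopped_value.
  apply: filterS (ae_root_time_barrier) => w [fw _] Aw.
  by rewrite normE//; exact: HT.
rewrite lin// (stopped_value_martingale s0 FA sA) -lin//.
by apply: eq_integral => w /[!inE] Aw; rewrite normE//; exact: HB.
Qed.

Lemma integral_stopped_dist_barrier s x : 0 < s -> (r x%:E <= s%:E)%E ->
  (\int[P]_w (`|T w - x|)%:E = \int[P]_w (`|X s w - x|)%:E)%E.
Proof.
move=> s0 rx.
have md : measurable_fun [set: R] (fun y : R => (`|y - x|)%:E).
  by apply/measurable_EFinP/measurableT_comp => //; exact: measurable_funB.
have mTd : measurable_fun setT (fun w => (`|T w - x|)%:E).
  by apply: (measurableT_comp md); exact: measurable_stopped_value.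
have mBd : measurable_fun setT (fun w => (`|B s w - x|)%:E) by exact: (measurableT_comp md).
rewrite (integral_stopped_process s md) (integral_split s mTd); congr (_ + _)%E.
(* Both halves are known at time [s]. Paths with [B s w = x] go to the lower half. *)
pose Ap := after s `&` (B s @^-1` `]x, +oo[).
pose Am := after s `&` (B s @^-1` `]-oo, x]).
have FAp : F s Ap.
  apply: natural_filtrationI; first exact: stopping_time_ge.
  by apply: natural_filtration_preimage; [exact: ltW|exact: measurable_itv].
have FAm : F s Am.
  apply: natural_filtrationI; first exact: stopping_time_ge.
  by apply: natural_filtration_preimage; [exact: ltW|exact: measurable_itv].
have AE : after s = Ap `|` Am.
  rewrite -setIUr -preimage_setU; apply/seteqP; split=> w /=; last by case.
  by move=> h; split => //; rewrite !in_itv/= andbT; case: (ltP x (B s w)); [left|right].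
have dis : [disjoint Ap & Am].
  by apply/disj_setPS => w [[_ /= +] [_ /=]]; rewrite !in_itv/= andbT leNgt => ->.
have side w : tau w \is a fin_num -> after s w ->
    (x < B s w -> x <= T w) /\ (B s w <= x -> T w <= x).
  move=> fw sw; apply: (root_time_side hRb hB (s := s)) => //; first by rewrite fineK.
  by rewrite -lee_fin fineK.
rewrite AE !integral_setU//; last 6 first.
- exact: natural_filtration_measurable FAp.
- exact: natural_filtration_measurable FAm.
- exact: measurable_funTS.
- exact: natural_filtration_measurable FAp.
- exact: natural_filtration_measurable FAm.
- exact: measurable_funTS.
congr (_ + _)%E.
- apply: (@integral_dist_side s x 1) => //.
  + by rewrite normr1.
  + by move=> w [].
  + by move=> w [_ /=]; rewrite in_itv/= andbT mul1r subr_ge0 => /ltW.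
  + move=> w [sw /=]; rewrite in_itv/= andbT mul1r subr_ge0 => xB fw.
    exact: (side w fw sw).1.
- apply: (@integral_dist_side s x (-1)) => //.
  + by rewrite normrN1.
  + by move=> w [].
  + by move=> w [_ /=]; rewrite in_itv/= mulN1r opprB subr_ge0.
  + move=> w [sw /=]; rewrite in_itv/= mulN1r opprB subr_ge0 => xB fw.
    exact: (side w fw sw).2.
Qed.

(** * Potentials and the equation *)

Lemma potential_difference x :
  (\int[P]_w (`|T w - x|)%:E =
   (`|x| + (potential \d_(0 : measurableTypeR R) x - potential mu x))%:E)%E.
Proof.
have md : measurable_fun [set: R] (fun y : R => (`|y - x|)%:E).
  by apply/measurable_EFinP/measurableT_comp => //; exact: measurable_funB.
have iTd := integrable_dist x integrable_stopped_value.
have fT := integrable_fin_num measurableT iTd.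
have E : (\int[P]_w (`|T w - x|)%:E = \int[mu]_y (`|x - y|)%:E)%E.
  rewrite (ge0_integral_law md)//.
  by apply: eq_integral => y _; rewrite distrC.
rewrite /potential /Rintegral opprK -E integral_dirac//; last first.
  by apply/measurable_EFinP/measurableT_comp => //; exact: measurable_funB.
by rewrite diracT mul1e /= subr0 addrA subrr add0r fineK.
Qed.

Lemma volterra_rhs_le s x : volterra_rhs mu r s x <= g s x.
Proof.
rewrite /volterra_rhs lerBlDr lerDl; apply: Rintegral_ge0 => y _.
exact: (g_ge0 hB).
Qed.

(** Jensen's inequality for the centred variable [T]; this is the lower bound when [r x = 0]. *)
Lemma potential_difference_ge0 x :
  0 <= potential \d_(0 : measurableTypeR R) x - potential mu x.
Proof.
have I : P.-integrable setT (fun w => (T w)%:E - x%:E)%E.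
  apply: integrableB => //; first exact: integrable_stopped_value.
  exact: finite_measure_integrable_cst.
have := le_abse_integral P measurableT (measurable_int _ I).
rewrite integralB//; last first.
- exact: finite_measure_integrable_cst.
- exact: integrable_stopped_value.
rewrite (integral_stopped_value) integral_probability_cst sub0e.
under eq_integral do rewrite -EFinB.
by rewrite potential_difference /= lee_fin normrN lerDl.
Qed.

(** Valid for every positive [s >= r x] and not just at [s = r x]: when [r x = 0] this freedom
    allows [s] to tend to 0. *)
Lemma potential_difference_eq s x : 0 < s -> (r x%:E <= s%:E)%E ->
  potential \d_(0 : measurableTypeR R) x - potential mu x = volterra_rhs mu r s x.
Proof.
move=> s0 rx; have := integral_stopped_dist_barrier s0 rx.
rewrite potential_difference (integral_stopped_process_dist x s0).
by move=> -[] /addrI.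
Qed.

(** The two sides differ by [E|X_s - x| - E|T - x|], which the L1 distance of [X s] and [T]
    bounds. *)
Lemma volterra_rhs_cvg x : volterra_rhs mu r s x @[s --> +oo] -->
  potential \d_(0 : measurableTypeR R) x - potential mu x.
Proof.
apply/cvgrPdist_le => e e0.
have [n Hn] := stopped_process_L1 e0.
near=> s.
have s0 : 0 < s by near: s; exact: nbhs_pinfty_gt.
have ns : n%:R <= s by near: s; exact: nbhs_pinfty_ge.
have L := Hn s ns s0.
have mX := measurable_stopped_process s.
have h1 := integral_dist_lip x mX measurable_stopped_value L.
have L' : (\int[P]_w (`|T w - X s w|)%:E <= e%:E)%E.
  by under eq_integral do rewrite distrC.
have h2 := integral_dist_lip x measurable_stopped_value mX L'.
move: h1 h2; rewrite potential_difference (integral_stopped_process_dist x s0).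
rewrite -!EFinD !lee_fin => h1 h2.
by rewrite ler_norml; apply/andP; split; lra.
Unshelve. all: by end_near. Qed.

Lemma volterra_equation x : volterra_equation_at mu r x.
Proof.
split; last by move=> _; exact: volterra_rhs_cvg.
move=> s rx; have : 0 <= s by rewrite -lee_fin -rx barrier_function_ge0.
rewrite le_eqVlt => /predU1P[s0|s0]; last first.
  by apply: potential_difference_eq => //; rewrite rx.
(* At [s = 0] the value of [g] is 0 and no [y] satisfies [r y < 0]. *)
have rhs0 : volterra_rhs mu r s x = 0.
  rewrite /volterra_rhs -s0 {1}/g lexx sub0r.
  rewrite (_ : [set y : R | _] = set0) ?Rintegral_set0 ?oppr0//.
  by apply/seteqP; split => // y /=; rewrite ltNge barrier_function_ge0.
rewrite rhs0; apply/eqP; rewrite eq_le potential_difference_ge0 andbT.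
apply/ler_addgt0Pl => e e0; rewrite addr0.
(* With this time the bound [sqrt (2 s / pi)] on [g s x] equals [e]. *)
have s'0 : 0 < pi * e ^+ 2 / 2 :> R by rewrite divr_gt0// mulr_gt0 ?pi_gt0// exprn_gt0.
rewrite (potential_difference_eq s'0); last by rewrite rx -s0 lee_fin ltW.
apply: le_trans (volterra_rhs_le _ _) _; apply: le_trans (g_le _ (ltW s'0)) _.
have -> : 2 * (pi * e ^+ 2 / 2) / pi = e ^+ 2 :> R.
  by have := pi_gt0 R; move: (pi : R) => p p0; field; rewrite gt_eqF.
by rewrite sqrtr_sqr gtr0_norm.
Qed.

End Volterra.

Theorem theorem2 (R : realType) (d : measure_display)
    (Omega : measurableType d) (P : probability Omega R)
    (B : R -> {RV P >-> R}) (hB : brownian_motion B)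
    (mu : probability (measurableTypeR R) R)
    (mu_atom_free : atom_free mu) (mu_zero_mean : zero_mean mu)
    (Rb : set (\bar R * \bar R)) (hRb : root_barrier Rb)
    (Rb_regular : regular_barrier (barrier_function Rb))
    (Rb_solves : solves_skorokhod B mu (root_time B Rb)) :
  forall x : R, volterra_equation_at mu (barrier_function Rb) x.
Proof.
exact: (volterra_equation hB mu_atom_free mu_zero_mean hRb Rb_solves).
Qed.
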